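(* Let $K$ be a noetherian UFD, $n\in\mathbb{N}$, $K[Z_0,\dots,Z_{n+1}]$ a polynomial ring in $n+2$ variables over $K$, $u_i,v_i\in K^*$ and $a_i,b_i$ positive integers with $\gcd(a_i,b_1\cdots b_i)=1$ for $1\le i\le n$. Let $f_1,\dots,f_n\in K\setminus\{0\}$ be such that the set of prime factors of $f_i$ in $K$ is the same for all $i=1,\dots,n$. Define $$A_n=K[Z_0,\dots,Z_{n+1}]/\big(f_iZ_{i+1}+u_iZ_i^{a_i}+v_iZ_{i-1}^{b_i}\big)_{1\le i\le n}.$$ Then $A_n$ is a UFD and $\mathrm{frac}(A_n)\cong\mathrm{frac}(K[Z_0,Z_1])\cong(\mathrm{frac}\,K)^{(2)}$.
   Context: $K^*$ denotes the unit group of $K$; for a field $L$, $L^{(2)}$ is the field of rational functions in two variables over $L$. *)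

(* Defs.v *)
From HB Require Import structures.
From mathcomp Require Import all_boot all_order all_algebra.
From mathcomp Require Import fraction.
From mathcomp.multinomials Require Import mpoly.
Set Implicit Arguments. Unset Strict Implicit. Unset Printing Implicit Defensive.
Import Order.TTheory GRing.Theory Num.Theory.
Local Open Scope ring_scope.

Section RingNotions.
Variable R : comPzRingType.

Definition is_unit (x : R) : Prop := exists y : R, x * y = 1.
Definition divides (x y : R) : Prop := exists c : R, y = x * c.

Definition is_domain : Prop :=
  (1 : R) <> 0 /\ forall x y : R, x * y = 0 -> x = 0 \/ y = 0.

Definition is_irreducible (x : R) : Prop :=
  x <> 0 /\ ~ is_unit x /\
  forall a b : R, x = a * b -> is_unit a \/ is_unit b.

Definition is_prime_elt (p : R) : Prop :=
  p <> 0 /\ ~ is_unit p /\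
  forall a b : R, divides p (a * b) -> divides p a \/ divides p b.

(* UFD: an integral domain in which every nonzero nonunit is a finite product
   of irreducible elements and every irreducible element is prime
   (equivalently: the factorization into irreducibles is unique up to order
   and associates). *)
Definition is_UFD : Prop :=
  is_domain /\
  (forall x : R, x <> 0 -> ~ is_unit x ->
     exists s : seq R, (forall r, r \in s -> is_irreducible r) /\
                       x = \prod_(r <- s) r) /\
  (forall x : R, is_irreducible x -> is_prime_elt x).

Definition is_ideal (I : R -> Prop) : Prop :=
  I 0 /\ (forall x y, I x -> I y -> I (x + y)) /\
  (forall r x, I x -> I (r * x)).

Definition ideal_generated_by (gs : seq R) (x : R) : Prop :=
  exists c : 'I_(size gs) -> R, x = \sum_(i < size gs) c i * gs`_i.

Definition is_noetherian : Prop :=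
  forall I : R -> Prop, is_ideal I ->
    exists gs : seq R, forall x, I x <-> ideal_generated_by gs x.

End RingNotions.

Definition gen_rel (K : idomainType) (n : nat)
    (f u v : nat -> K) (a b : nat -> nat) (i : nat) : {mpoly K[n.+2]} :=
  (f i)%:MP * 'X_(inord i.+1) + (u i)%:MP * 'X_(inord i) ^+ a i
  + (v i)%:MP * 'X_(inord i.-1) ^+ b i.

Definition gen_rels (K : idomainType) (n : nat)
    (f u v : nat -> K) (a b : nat -> nat) : seq {mpoly K[n.+2]} :=
  [seq gen_rel n f u v a b i | i <- iota 1 n].

Definition is_fraction_field (A : comPzRingType) (L : fieldType)
    (iota : {rmorphism A -> L}) : Prop :=
  injective iota /\
  forall z : L, exists x y : A, iota y != 0 /\ z = iota x / iota y.

(* Main.v *)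
Require Import Defs.
From HB Require Import structures.
From Stdlib Require Import Classical.
From mathcomp Require Import all_boot all_order all_algebra.
From mathcomp Require Import fraction ring zify.
From mathcomp.multinomials Require Import mpoly.
Set Implicit Arguments. Unset Strict Implicit. Unset Printing Implicit Defensive.
Import Order.TTheory GRing.Theory Num.Theory.
Local Open Scope ring_scope.

(** Inverting the nonzero constants of K turns A_n into Frac(K)[X_0, X_1], since
each relation then expresses Z_{i+1} through Z_i and Z_{i-1}.  By Nagata's
criterion it suffices that the primes p of K remain prime in the noetherian ring
A_n and that A_n embeds in this localisation.

Let p divide all the f_i.  Modulo p the relations become the binomials
u_i Z_i^{a_i} + v_i Z_{i-1}^{b_i}.  These have a solution in the units of K, and
the Z_i can be given weights so that coprimality makes distinct monomials with
exponents below a_i in Z_i (1 <= i <= m) have distinct weights; hence the ideal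
of p and the first m binomials is the preimage of (p) under a monomial
parametrization, and is prime.  Going through the relations one at a time, this
shows that p is a nonzerodivisor in A_n, so the product t of the f_i is one too
and A_n embeds in A_n[1/t] = K[1/t][X_0, X_1].  The primes of K not dividing t
are prime in K[X_0, X_1], and they stay prime in A_n because the primes dividing
t do not divide them. *)

(** * Divisibility and prime factorizations *)

(** No localisation is constructed: [{mpoly {fraction K}[2]}] stands in for it, since the criterion
    only asks that each of its elements come from [A] after multiplication by a product of primes.
    The relations can be solved there, so [A] maps to it at once; the difficulty is injectivity. An
    element of the kernel is killed by a power of [t], so each prime [p] dividing [t] must be
    regular modulo all the relations. Induction on their number needs primality of the ideal of [p]
    and the first [m] relations for every [m], together with the fact that relation [m.+1] lies
    outside it. The assumption on prime factors enters here: a prime dividing one [f i] divides all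
    of them, so no relation keeps its term in [Z_{i+1}] modulo [p]. As the [u i] and [v i] are
    arbitrary units, a monomial curve kills the binomials only after its coordinates are scaled by a
    solution in units; Bezout's identity for [a i] and [b 1 ... b i] provides one without extracting
    roots. *)

Definition product_of (R : comPzRingType) (P : R -> Prop) (x : R) : Prop :=
  exists s : seq R, (forall r, r \in s -> P r) /\ x = \prod_(r <- s) r.

(** In a domain this is equivalent to [is_UFD]. Phrased with primes and a unit factor, it needs no
    exception for units and descends well from a localisation. *)
Definition is_factorial (R : comPzRingType) : Prop :=
  forall x : R, x <> 0 ->
    exists u c, [/\ is_unit u, product_of (@is_prime_elt R) c & x = u * c].

Lemma divides_refl (R : comPzRingType) (x : R) : divides x x.
Proof. by exists 1; rewrite mulr1. Qed.

Lemma divides_trans (R : comPzRingType) (y x z : R) :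
  divides x y -> divides y z -> divides x z.
Proof. by move=> [c ->] [d ->]; exists (c * d); rewrite mulrA. Qed.

Lemma divides_mulr (R : comPzRingType) (x y z : R) :
  divides x y -> divides x (y * z).
Proof. by move=> [c ->]; exists (c * z); rewrite mulrA. Qed.

Lemma divides_mull (R : comPzRingType) (x y z : R) :
  divides x y -> divides x (z * y).
Proof. by rewrite mulrC; apply: divides_mulr. Qed.

Lemma dividesD (R : comPzRingType) (x y z : R) :
  divides x y -> divides x z -> divides x (y + z).
Proof. by move=> [c ->] [d ->]; exists (c + d); rewrite mulrDr. Qed.

Lemma is_unitM (R : comPzRingType) (x y : R) :
  is_unit x -> is_unit y -> is_unit (x * y).
Proof. by move=> [a Ha] [b Hb]; exists (a * b); rewrite mulrACA Ha Hb mulr1. Qed.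

Lemma is_unit_divides (R : comPzRingType) (x y : R) :
  divides x y -> is_unit y -> is_unit x.
Proof. by move=> [c ->] [a Ha]; exists (c * a); rewrite mulrA. Qed.

Lemma divides_unit_mul (R : comPzRingType) (u x y : R) :
  is_unit u -> divides x (u * y) -> divides x y.
Proof.
move=> [w Hw] [c Hc]; exists (w * c).
by rewrite mulrCA -Hc mulrA [w * u]mulrC Hw mul1r.
Qed.

Lemma product_of1 (R : comPzRingType) (P : R -> Prop) : product_of P 1.
Proof. by exists [::]; split=> //; rewrite big_nil. Qed.

Lemma product_ofM (R : comPzRingType) (P : R -> Prop) (x y : R) :
  product_of P x -> product_of P y -> product_of P (x * y).
Proof.
move=> [s [Hs ->]] [t [Ht ->]]; exists (s ++ t); rewrite big_cat; split=> // r.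
by rewrite mem_cat => /orP[/Hs|/Ht].
Qed.

Lemma product_of_single (R : comPzRingType) (P : R -> Prop) (x : R) :
  P x -> product_of P x.
Proof.
move=> Hx; exists [:: x]; split; last by rewrite big_seq1.
by move=> r; rewrite inE => /eqP->.
Qed.

Lemma product_of_ind (R : comPzRingType) (P Q : R -> Prop) :
  Q 1 -> (forall p x, P p -> Q x -> Q (p * x)) ->
  forall x, product_of P x -> Q x.
Proof.
move=> Q1 QM x [s [Hs ->]]; elim: s Hs => [|r s IH] H; first by rewrite big_nil.
rewrite big_cons; apply: QM; first by apply: H; rewrite inE eqxx.
by apply: IH => q Hq; apply: H; rewrite inE Hq orbT.
Qed.

Lemma product_of_sub (R : comPzRingType) (P Q : R -> Prop) (x : R) :
  (forall r, P r -> Q r) -> product_of P x -> product_of Q x.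
Proof. by move=> PQ [s [Hs ->]]; exists s; split=> // r /Hs /PQ. Qed.

Lemma domain_mulI (R : comPzRingType) (x y z : R) :
  is_domain R -> x <> 0 -> x * y = x * z -> y = z.
Proof.
move=> [_ dom] nzx /eqP; rewrite -subr_eq0 -mulrBr => /eqP /dom [//|/eqP].
by rewrite subr_eq0 => /eqP.
Qed.

Lemma divides_cancel (R : comPzRingType) (x y z : R) :
  is_domain R -> x <> 0 -> divides (x * y) (x * z) -> divides y z.
Proof.
by move=> dom nzx [c]; rewrite -mulrA => /(domain_mulI dom nzx) ->; exists c.
Qed.

Lemma prime_irreducible (R : comPzRingType) (p : R) :
  is_domain R -> is_prime_elt p -> is_irreducible p.
Proof.
move=> dom [nzp [nup pr]]; split=> //; split=> // a b Hab.
have key c d : p = c * d -> divides p c -> is_unit d.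
  move=> Hp [e He]; exists e; apply: (domain_mulI dom nzp).
  by rewrite mulr1 mulrCA -He mulrC -Hp.
have [||] := pr a b; first by rewrite -Hab; apply: divides_refl.
  by move/(key a b Hab); right.
by rewrite mulrC in Hab; move/(key b a Hab); left.
Qed.

Lemma prime_mul_unit (R : comPzRingType) (p w : R) :
  is_prime_elt p -> is_unit w -> is_prime_elt (p * w).
Proof.
move=> [nzp [nup pr]] [w' Hw]; split.
  by move=> H; apply: nzp; rewrite -[p]mulr1 -Hw mulrA H mul0r.
split; first by move=> [c Hc]; apply: nup; exists (w * c); rewrite mulrA.
have dvd x : divides (p * w) x <-> divides p x.
  split=> [[c ->]|[c ->]]; first by exists (w * c); rewrite mulrA.
  by exists (w' * c); rewrite mulrA -[p * w * w']mulrA Hw mulr1.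
by move=> a b /dvd /pr [] /dvd; [left | right].
Qed.

Lemma prime_divides_prod (R : comPzRingType) (p : R) (s : seq R) :
  is_prime_elt p -> divides p (\prod_(r <- s) r) ->
  exists2 r, r \in s & divides p r.
Proof.
move=> [_ [nup pr]]; elim: s => [|r s IH]; rewrite ?big_nil ?big_cons.
  by move=> [c Hc]; case: nup; exists c.
move=> /pr [H|/IH [q Hq Hpq]]; first by exists r; rewrite ?inE ?eqxx.
by exists q; rewrite ?inE ?Hq ?orbT.
Qed.

Lemma prime_divides_prime (R : comPzRingType) (p q : R) :
  is_domain R -> is_prime_elt p -> is_prime_elt q -> divides p q ->
  exists2 w, is_unit w & q = p * w.
Proof.
move=> dom [_ [nup _]] /(prime_irreducible dom) [_ [_ irr]] [w Hw].
by exists w => //; case: (irr _ _ Hw).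
Qed.

Lemma UFD_factorial (R : comPzRingType) : is_UFD R -> is_factorial R.
Proof.
move=> [_ [ex ip]] x nzx; have [ux|nux] := classic (is_unit x).
  by exists x, 1; split=> //; [apply: product_of1 | rewrite mulr1].
have [s [Hs ->]] := ex x nzx nux; exists 1, (\prod_(r <- s) r).
split; [by exists 1; rewrite mulr1 | | by rewrite mul1r].
by exists s; split=> // r /Hs /ip.
Qed.

(** A nonunit has at least one prime factor, which can absorb the unit. For an irreducible element
    the remaining cofactor is then a unit, so the element is associate to a prime. *)
Lemma factorial_UFD (R : comPzRingType) : is_domain R -> is_factorial R -> is_UFD R.
Proof.
move=> dom fac.
have dec (x : R) : x <> 0 -> ~ is_unit x -> exists r s,
  [/\ is_prime_elt r, forall q, q \in s -> is_prime_elt q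
    & x = r * \prod_(q <- s) q].
  move=> nzx nux; have [u [c [uu [[|r s] [Hs ->]] Hx]]] := fac x nzx.
    by case: nux; rewrite Hx big_nil mulr1.
  exists (r * u), s; split.
  - by apply: prime_mul_unit => //; apply: Hs; rewrite inE eqxx.
  - by move=> q Hq; apply: Hs; rewrite inE Hq orbT.
  - by rewrite Hx big_cons mulrA [u * r]mulrC.
split=> //; split=> [x nzx nux | x [nzx [nux irr]]].
  have [r [s [Hr Hs ->]]] := dec x nzx nux.
  exists (r :: s); rewrite big_cons; split=> // q.
  by rewrite inE => /orP[/eqP->|/Hs]; apply: prime_irreducible.
have [r [s [Hr Hs Hx]]] := dec x nzx nux.
have [|uw] := irr _ _ Hx; first by case: Hr => _ [].
by rewrite Hx; apply: prime_mul_unit.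
Qed.

(** The first prime of [s] divides some prime of [t], hence is associate to it; both are cancelled
    and the induction continues. This count bounds multiplicities in place of unique
    factorization. *)
Lemma size_prime_divisors (R : comPzRingType) (s t : seq R) :
  is_domain R -> (forall r, r \in s -> is_prime_elt r) ->
  (forall r, r \in t -> is_prime_elt r) ->
  divides (\prod_(r <- s) r) (\prod_(r <- t) r) -> (size s <= size t)%N.
Proof.
move=> dom; elim: s t => [//|p s IH] t Hs Ht.
have pp : is_prime_elt p by apply: Hs; rewrite inE eqxx.
rewrite big_cons => dv.
have [r rt pr] : exists2 r, r \in t & divides p r.
  by apply: prime_divides_prod pp _; apply: divides_trans dv; exists (\prod_(q <- s) q).
have [w uw rE] := prime_divides_prime dom pp (Ht r rt) pr.
have := perm_to_rem rt => /[dup] /perm_size /= ->; rewrite ltnS => pt.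
apply: IH => [q Hq|q /mem_rem /Ht//|]; first by apply: Hs; rewrite inE Hq orbT.
move: dv; rewrite (perm_big _ pt) /= big_cons rE -mulrA.
by case: pp => nzp _ /(divides_cancel dom nzp) /(divides_unit_mul uw).
Qed.

Lemma is_ideal_generated (R : comPzRingType) (gs : seq R) :
  is_ideal (ideal_generated_by gs).
Proof.
split; first by exists (fun => 0); rewrite big1 // => i _; rewrite mul0r.
split=> [x y [c ->] [d ->] | r x [c ->]].
  by exists (fun i => c i + d i); rewrite -big_split; apply: eq_bigr => i _; rewrite mulrDl.
by exists (fun i => r * c i); rewrite mulr_sumr; apply: eq_bigr => i _; rewrite mulrA.
Qed.

Lemma mem_ideal_generated (R : comPzRingType) (gs : seq R) (g : R) :
  g \in gs -> ideal_generated_by gs g.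
Proof.
move=> gin; pose i := Ordinal (etrans (index_mem g gs) gin).
exists (fun k => (k == i)%:R); rewrite (bigD1 i) //= eqxx mul1r nth_index //.
by rewrite big1 ?addr0 // => k /negbTE ->; rewrite mul0r.
Qed.

Lemma ideal_generated_min (R : comPzRingType) (gs : seq R) (I : R -> Prop) :
  is_ideal I -> (forall g, g \in gs -> I g) -> forall x, ideal_generated_by gs x -> I x.
Proof.
move=> [I0 [ID IM]] Hg x [c ->]; elim/big_ind: _ => [//|//|i _].
by apply/IM/Hg/mem_nth.
Qed.

(* The ideal of the [z] with [c * z] divisible by [x] for some product [c] of
   elements of [P] is finitely generated, so one [c] serves all [z]; its number
   of factors bounds the number of factors of [x] taken from [P]. *)
Lemma split_off_primes (R : comPzRingType) (P : R -> Prop) (x : R) :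
  is_domain R -> is_noetherian R -> (forall p, P p -> is_prime_elt p) ->
  x <> 0 -> exists c y, [/\ product_of P c, x = c * y & forall p, P p -> ~ divides p y].
Proof.
move=> dom noe PP nzx.
pose I z := exists2 c, product_of P c & divides x (c * z).
have [gs Hgs] : exists gs, forall z, I z <-> ideal_generated_by gs z.
  apply: noe; split; last split.
  - by exists 1; [apply: product_of1 | exists 0; rewrite !mulr0].
  - move=> z z' [c Hc dc] [c' Hc' dc']; exists (c * c'); first exact: product_ofM.
    rewrite mulrDr; apply: dividesD; last by rewrite -mulrA; apply: divides_mull.
    by rewrite mulrAC; apply: divides_mulr.
  - by move=> r z [c Hc dc]; exists c => //; rewrite mulrCA; apply: divides_mull.
have gI g : g \in gs -> I g by move=> /mem_ideal_generated /Hgs.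
have [c0 [Hc0 c0P]] : exists c0, product_of P c0 /\ forall g, g \in gs -> divides x (c0 * g).
  elim: (gs) gI => [|g s IH] H; first by exists 1; split=> //; apply: product_of1.
  have [c [Hc cP]] : exists c, product_of P c /\ forall h, h \in s -> divides x (c * h).
    by apply: IH => h Hh; apply: H; rewrite inE Hh orbT.
  have [|d Hd dP] := H g; first by rewrite inE eqxx.
  exists (c * d); split; first exact: product_ofM.
  move=> h; rewrite inE => /orP[/eqP->|/cP]; first by rewrite -mulrA; apply: divides_mull.
  by rewrite mulrAC; apply: divides_mulr.
have c0I z : I z -> divides x (c0 * z).
  move=> /Hgs [e ->]; rewrite mulr_sumr; elim/big_ind: _ => [||i _].
  - by exists 0; rewrite mulr0.
  - by move=> ? ? ? ?; apply: dividesD.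
  - by rewrite mulrCA; apply/divides_mull/c0P/mem_nth.
have [s0 [Hs0 c0E]] := Hc0.
apply: NNPP => H.
(* If the primes of [P] never ran out, any number of them could be split off [x]; one more than [c0]
   has factors already contradicts the count. *)
have long k : exists s y, [/\ size s = k, forall r, r \in s -> P r & x = (\prod_(r <- s) r) * y].
  elim: k => [|k [s [y [Hk Hs xE]]]]; first by exists [::], x; rewrite big_nil mul1r.
  apply: NNPP => H'; apply: H; exists (\prod_(r <- s) r), y; split=> //; first by exists s.
  move=> p Hp [y' Hy']; apply: H'; exists (p :: s), y'; split; first by rewrite /= Hk.
    by move=> r; rewrite inE => /orP[/eqP->|/Hs].
  by rewrite big_cons xE Hy' mulrA [p * _]mulrC.
have [s [y [Hk Hs xE]]] := long (size s0).+1.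
have nzy : y <> 0 by move=> y0; apply: nzx; rewrite xE y0 mulr0.
have : divides x (c0 * y).
  by apply: c0I; exists (\prod_(r <- s) r); [exists s | rewrite -xE; apply: divides_refl].
rewrite xE [_ * y]mulrC [c0 * y]mulrC c0E => /(divides_cancel dom nzy).
move=> /size_prime_divisors; rewrite Hk ltnn => H2.
by have : false by apply: H2 => // r; [move/Hs/PP | move/Hs0/PP].
Qed.

Lemma product_of_neq0 (R : comPzRingType) (P : R -> Prop) (c : R) :
  is_domain R -> (forall p, P p -> is_prime_elt p) -> product_of P c -> c <> 0.
Proof.
move=> [nz1 dom] PP; move: c.
apply: (product_of_ind (Q := fun c => c <> 0)) => // p x /PP [nzp _] nzx.
by move/dom=> [].
Qed.

(** A prime [p] of [c] divides [y * e] but not [y], so it divides [e] and cancels; repeating this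
    removes all of [c]. *)
Lemma coprime_divides_mul (R : comPzRingType) (P : R -> Prop) (c y x : R) :
  is_domain R -> (forall p, P p -> is_prime_elt p) -> product_of P c ->
  (forall p, P p -> ~ divides p y) -> divides y (c * x) -> divides y x.
Proof.
move=> dom PP Pc ndy; move: c Pc x; apply: product_of_ind; first by move=> x; rewrite mul1r.
move=> p c Pp IH x; rewrite -mulrA => -[e He]; apply: IH.
have [nzp [_ pr]] := PP p Pp.
have [||[e' He']] := pr y e; first by rewrite -He; exists (c * x).
  by move/(ndy p Pp).
by exists e'; apply: (domain_mulI dom nzp); rewrite He He' mulrCA.
Qed.

(* Nagata's criterion; [E] plays the role of the localisation of [R] at the
   products of elements of [P]. *)
Lemma factorial_localization (R E : comPzRingType) (j : {rmorphism R -> E})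
    (P : R -> Prop) :
  is_domain R -> is_domain E -> is_noetherian R -> injective j ->
  (forall p, P p -> is_prime_elt p) -> (forall p, P p -> is_unit (j p)) ->
  (forall e : E, exists c x, product_of P c /\ j c * e = j x) ->
  is_factorial E -> is_factorial R.
Proof.
move=> dom domE noe inj PP Pu frac facE x nzx.
have split (y : R) : y <> 0 -> exists c z,
    [/\ product_of P c, y = c * z & forall p, P p -> ~ divides p z].
  exact: split_off_primes.
have uP c : product_of P c -> is_unit (j c).
  move: c; apply: product_of_ind => [|p c /Pu up uc]; rewrite ?rmorph1 ?rmorphM.
    by exists 1; rewrite mulr1.
  exact: is_unitM.
have j0 (y : R) : y <> 0 -> j y <> 0 by move=> nzy; rewrite -(rmorph0 j) => /inj.
(* Divisibility in [E] descends to [R] when the divisor has no factor in [P]: the denominator of the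
   quotient is a product of primes of [P], and these cancel. *)
have desc (y z : R) : (forall p, P p -> ~ divides p y) -> divides (j y) (j z) -> divides y z.
  move=> ndy [e He]; have [c [w [Pc Hw]]] := frac e.
  apply: (coprime_divides_mul dom PP Pc ndy); exists w; apply: inj.
  by rewrite !rmorphM He -Hw mulrCA.
have main s : (forall r, r \in s -> is_prime_elt r) -> forall y eps,
    is_unit eps -> (forall p, P p -> ~ divides p y) -> y <> 0 -> j y = eps * \prod_(r <- s) r ->
    exists u c, [/\ is_unit u, product_of (@is_prime_elt R) c & y = u * c].
  elim: s => [_ y eps ueps ndy nzy | q s IH Hs y eps ueps ndy nzy].
    rewrite big_nil mulr1 => jy; exists y, 1; split; last by rewrite mulr1.
      have [|e He] := desc y 1 ndy; last by exists e.
      by rewrite rmorph1 jy; case: ueps => e He; exists e.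
    exact: product_of1.
  have pq : is_prime_elt q by apply: Hs; rewrite inE eqxx.
  rewrite big_cons => jy; have [c [w [Pc Hw]]] := frac q.
  have nzw : w <> 0.
    move=> w0; case: pq => nzq _; case: domE => _ /(_ _ _ (etrans Hw _)).
    rewrite w0 rmorph0 => /(_ erefl) [] //; apply: j0.
    exact: product_of_neq0 PP Pc.
  (* [z] is the prime [q] of [E] with its denominator cleared and its factors from [P] removed. It
     generates the same ideal of [E] as [q], and by [desc] divisibility by [z] can be tested in [E],
     so [z] is prime in [R]. *)
  have [d [z [Pd wE ndz]]] := split w nzw.
  have [dv Hdv] := uP d Pd.
  have jz : j z = q * (j c * dv).
    by rewrite mulrA [q * _]mulrC Hw wE rmorphM mulrAC Hdv mul1r.
  have uz : is_unit (j c * dv) by apply: is_unitM; [exact: uP | exists (j d); rewrite mulrC].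
  have pjz : is_prime_elt (j z) by rewrite jz; apply: prime_mul_unit.
  have pz : is_prime_elt z.
    case: pjz => nz [nu pr]; split; first by move=> z0; apply: nz; rewrite z0 rmorph0.
    split; first by move=> [e He]; apply: nu; exists (j e); rewrite -rmorphM He rmorph1.
    move=> a b [e He]; have [||] := pr (j a) (j b); last by move/desc=> H; right; apply: H.
      by exists (j e); rewrite -!rmorphM He.
    by move/desc=> H; left; apply: H.
  have [y' yE] : divides z y.
    apply: desc => //; rewrite jz jy; case: uz => t Ht.
    exists (t * (eps * \prod_(r <- s) r)).
    have -> : q * (j c * dv) * (t * (eps * \prod_(r <- s) r))
      = (j c * dv * t) * (eps * (q * \prod_(r <- s) r)) by ring.
    by rewrite Ht mul1r.
  have nzy' : y' <> 0 by move=> y0; apply: nzy; rewrite yE y0 mulr0.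
  have ndy' p : P p -> ~ divides p y'.
    by move=> Pp dp; apply: (ndy p Pp); rewrite yE; apply: divides_mull.
  have [t Ht] := uz.
  have jy' : j y' = (t * eps) * \prod_(r <- s) r.
    have nzq : q <> 0 by case: pq.
    apply: (domain_mulI domE nzq); set k := j c * dv in jz Ht.
    have -> : q * (t * eps * \prod_(r <- s) r) = t * (eps * (q * \prod_(r <- s) r)).
      by ring.
    rewrite -jy yE rmorphM jz.
    have -> : t * (q * k * j y') = k * t * (q * j y') by ring.
    by rewrite Ht mul1r.
  have [||u [c' [uu Pc' y'E]]] := IH _ y' (t * eps) _ ndy' nzy' jy'.
  - by move=> r Hr; apply: Hs; rewrite inE Hr orbT.
  - by apply: is_unitM => //; exists (j c * dv); rewrite mulrC.
  exists u, (z * c'); split=> //; last by rewrite yE y'E mulrCA.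
  by apply: product_ofM => //; apply: product_of_single.
have [c [y [Pc xE ndy]]] := split x nzx.
have nzy : y <> 0 by move=> y0; apply: nzx; rewrite xE y0 mulr0.
have [eps [c' [ueps [s [Hs ->]] jyE]]] := facE (j y) (j0 y nzy).
have [u [d [uu Pd yE]]] := main s Hs y eps ueps ndy nzy jyE.
exists u, (c * d); split=> //; last by rewrite xE yE mulrCA.
by apply: product_ofM => //; apply: product_of_sub Pc.
Qed.

(** * Noetherian rings *)

Lemma ideal_generated_sub (R : comPzRingType) (gs hs : seq R) (x : R) :
  {subset gs <= hs} -> ideal_generated_by gs x -> ideal_generated_by hs x.
Proof.
move=> sub; apply: ideal_generated_min => [|g /sub]; first exact: is_ideal_generated.
exact: mem_ideal_generated.
Qed.

Lemma noetherian_surj (R S : comPzRingType) (f : {rmorphism R -> S}) :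
  (forall y, exists x, f x = y) -> is_noetherian R -> is_noetherian S.
Proof.
move=> surj noe I [I0 [ID IM]].
have [gs Hgs] : exists gs, forall x, I (f x) <-> ideal_generated_by gs x.
  apply: (noe (fun x => I (f x))); split; first by rewrite rmorph0.
  by split=> [x y Ix Iy|r x Ix]; rewrite ?rmorphD ?rmorphM; auto.
exists (map f gs) => y; split=> [|[c ->]].
  have [x <-] := surj y => /Hgs.
  apply: (ideal_generated_min (I := fun x => ideal_generated_by (map f gs) (f x))).
    have [J0 [JD JM]] := is_ideal_generated (map f gs).
    by split=> [|]; rewrite ?rmorph0 //; split=> *; rewrite ?rmorphD ?rmorphM; auto.
  by move=> g Hg; apply/mem_ideal_generated/map_f.
elim/big_ind: _ => [//|//|i _]; apply: IM.
have li : (i < size gs)%N by rewrite -(size_map f).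
by rewrite (nth_map 0) //; apply/Hgs/mem_ideal_generated/mem_nth.
Qed.

Lemma noetherian_field (F : fieldType) : is_noetherian F.
Proof.
move=> I [I0 [_ IM]]; have [[x Ix nzx]|H] := classic (exists2 x, I x & x <> 0).
  exists [:: 1] => y; split=> [_|_].
    by exists (fun=> y); rewrite big_ord1 mulr1.
  by rewrite -[y](mulfVK (introN eqP nzx)); apply: IM.
exists [::] => y; split=> [Iy|[c ->]]; last by rewrite big_ord0.
exists (fun=> 0); rewrite big_ord0; apply: NNPP => nzy; apply: H; by exists y.
Qed.

(* Hilbert's basis theorem, via the ideals of the coefficients of ['X^d] in the
   elements of [I] of degree at most [d]. *)
Lemma noetherian_poly (R : comNzRingType) : is_noetherian R -> is_noetherian {poly R}.
Proof.
move=> noe I [I0 [ID IM]].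
pose L d c := exists p, [/\ I p, (size p <= d.+1)%N & p`_d = c].
have Lid d : is_ideal (L d).
  split; first by exists 0; rewrite size_poly0 coef0.
  split=> [x y [p [Ip sp <-]] [q [Iq sq <-]] | r x [p [Ip sp <-]]].
    exists (p + q); rewrite coefD; split=> //; first exact: ID.
    by rewrite (leq_trans (size_polyD _ _)) // geq_max sp sq.
  exists (r%:P * p); rewrite coefCM; split=> //; first exact: IM.
  by rewrite mul_polyC (leq_trans (size_scale_leq _ _)).
have LS d c m : L d c -> L (d + m)%N c.
  move=> [p [Ip sp <-]]; exists (p * 'X^m); split; first by rewrite mulrC; apply: IM.
    by rewrite (leq_trans (size_polyMleq _ _)) // size_polyXn addnS /= -addSn leq_add2r.
  by rewrite coefMXn ltnNge leq_addl /= addnK.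
(* The union of the increasing chain [L d] is again an ideal; its finitely many generators lie in a
   single [L N], where the chain stops. *)
have [N HN] : exists N, forall d c, L d c -> L N c.
  have [gs Hgs] : exists gs, forall c, (exists d, L d c) <-> ideal_generated_by gs c.
    apply: (noe (fun c => exists d, L d c)); split; first by exists 0%N; case: (Lid 0%N).
    split=> [x y [d dx] [e ey]|r x [d dx]]; last by exists d; case: (Lid d) => _ []; auto.
    exists (d + e)%N; have [_ [LD _]] := Lid (d + e)%N.
    by apply: LD; [apply: LS | rewrite addnC; apply: LS].
  have [N HN] : exists N, forall g, g \in gs -> L N g.
    have H g : g \in gs -> exists d, L d g by move=> /mem_ideal_generated /Hgs.
    elim: (gs) H => [|g s IH] H; first by exists 0%N.
    have [|N HN] := IH; first by move=> h Hh; apply: H; rewrite inE Hh orbT.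
    have [|d Hd] := H g; first by rewrite inE eqxx.
    exists (N + d)%N => h; rewrite inE => /orP[/eqP->|/HN /LS //].
    by rewrite addnC; apply: LS.
  exists N => d c dc; apply: (ideal_generated_min (Lid N) HN).
  by apply/Hgs; exists d.
have gen1 d : exists ps, (forall p, p \in ps -> I p) /\
    forall c, L d c -> exists q, [/\ ideal_generated_by ps q, (size q <= d.+1)%N & q`_d = c].
  have [gs Hgs] := noe (L d) (Lid d).
  have H g : g \in gs -> L d g by move=> /mem_ideal_generated /Hgs.
  suff [ps [Hps Hc]] : exists ps, (forall p, p \in ps -> I p) /\
     forall g, g \in gs -> exists q, [/\ ideal_generated_by ps q, (size q <= d.+1)%N & q`_d = g].
    exists ps; split=> // c /Hgs; move: c; apply: ideal_generated_min => //.
    have [J0 [JD JM]] := is_ideal_generated ps.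
    split; first by exists 0; rewrite size_poly0 coef0.
    split=> [x y [p [Ip sp <-]] [q [Iq sq <-]] | r x [p [Ip sp <-]]].
      exists (p + q); rewrite coefD; split=> //; first exact: JD.
      by rewrite (leq_trans (size_polyD _ _)) // geq_max sp sq.
    exists (r%:P * p); rewrite coefCM; split=> //; first exact: JM.
    by rewrite mul_polyC (leq_trans (size_scale_leq _ _)).
  elim: (gs) H => [|g s IH] H; first by exists [::].
  have [|ps [Hps Hq]] := IH; first by move=> h Hh; apply: H; rewrite inE Hh orbT.
  have [|p [Ip sp pg]] := H g; first by rewrite inE eqxx.
  exists (p :: ps); split=> [q|h]; rewrite inE => /orP[/eqP->|] //; first exact: Hps.
    by exists p; split=> //; apply: mem_ideal_generated; rewrite inE eqxx.
  move=> /Hq [q [Jq sq qh]]; exists q; split=> //; apply: ideal_generated_sub Jq.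
  by move=> r Hr; rewrite inE Hr orbT.
have [gs [gsI Hgs]] : exists gs, (forall p, p \in gs -> I p) /\ forall d c, (d <= N)%N -> L d c ->
    exists q, [/\ ideal_generated_by gs q, (size q <= d.+1)%N & q`_d = c].
  suff H m : exists gs, (forall p, p \in gs -> I p) /\ forall d c, (d < m)%N -> L d c ->
      exists q, [/\ ideal_generated_by gs q, (size q <= d.+1)%N & q`_d = c] by apply: (H N.+1).
  elim: m => [|m [gs [gsI IH]]]; first by exists [::].
  have [ps [psI Hps]] := gen1 m.
  exists (ps ++ gs); split=> [p|d c]; first by rewrite mem_cat => /orP[/psI|/gsI].
  rewrite ltnS leq_eqVlt => /orP[/eqP->|lt_dm].
    move=> /Hps [q [Jq sq qc]]; exists q; split=> //; apply: ideal_generated_sub Jq.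
    by move=> r Hr; rewrite mem_cat Hr.
  move=> /(IH _ _ lt_dm) [q [Jq sq qc]]; exists q; split=> //; apply: ideal_generated_sub Jq.
  by move=> r Hr; rewrite mem_cat Hr orbT.
exists gs => p; split; last exact: ideal_generated_min.
have [J0 [JD JM]] := is_ideal_generated gs.
have [n] := ubnP (size p); elim: n p => // n IH p; rewrite ltnS => sp Ip.
have [q [Jq Iq sq qp]] : exists q, [/\ ideal_generated_by gs q, I q,
    (size q <= (size p).-1.+1)%N & q`_(size p).-1 = p`_(size p).-1].
  have JI q : ideal_generated_by gs q -> I q by apply: ideal_generated_min.
  have Lp : L (size p).-1 p`_(size p).-1 by exists p; rewrite leqSpred.
  have [le_pN|lt_Np] := leqP (size p).-1 N.
    by have [q [Jq sq qp]] := Hgs _ _ le_pN Lp; exists q; split=> //; apply: JI.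
  have [q [Jq sq qp]] := Hgs _ _ (leqnn N) (HN _ _ Lp).
  have Jq' : ideal_generated_by gs (q * 'X^((size p).-1 - N)) by rewrite mulrC; apply: JM.
  exists (q * 'X^((size p).-1 - N)); split=> //; first exact: JI.
    rewrite (leq_trans (size_polyMleq _ _)) // size_polyXn addnS /=.
    by rewrite -{2}(subnKC (ltnW lt_Np)) -addSn leq_add2r.
  by rewrite coefMXn ltnNge leq_subr /= subKn // ltnW.
have -> : p = q + (p - q) by rewrite addrC subrK.
apply: JD => //.
(* For [p = 0] the bound [(size p).-1.+1] is 1 and the size cannot drop; there [q] is a constant
   whose value is 0. *)
have [p0|nzp] := eqVneq p 0.
  suff -> : p - q = 0 by [].
  rewrite p0 sub0r; apply/eqP; rewrite oppr_eq0; apply/eqP/polyP=> i; rewrite coef0.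
  case: i => [|i]; first by move: qp; rewrite p0 size_poly0 /= coef0.
  by move: sq; rewrite p0 size_poly0 /= => sq; rewrite nth_default // (leq_trans sq).
apply: IH; last by apply: ID => //; rewrite -mulN1r; apply: IM.
apply: leq_trans sp; rewrite -(ltn_predK (_ : 0 < size p)%N) ?size_poly_gt0 // ltnS.
apply/leq_sizeP => i; rewrite leq_eqVlt => /orP[/eqP<-|lti].
  by rewrite coefB qp subrr.
rewrite coefB !nth_default ?subrr //; first by rewrite (leq_trans sq).
by rewrite -(ltn_predK (_ : 0 < size p)%N) ?size_poly_gt0.
Qed.

(** * Polynomial rings over factorial rings *)

Lemma is_domain_idomain (R : idomainType) : is_domain R.
Proof.
split; first by apply/eqP/oner_neq0.
by move=> x y /eqP; rewrite mulf_eq0 => /orP[/eqP->|/eqP->]; [left|right].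
Qed.

Lemma is_unitP (R : comUnitRingType) (x : R) : is_unit x <-> x \is a GRing.unit.
Proof.
split=> [[y Hy]|ux]; last by exists x^-1; rewrite mulrV.
by apply/unitrPr; exists y.
Qed.

(** Induction on the size. A nonconstant [p] without nonconstant divisors of smaller size is prime:
    if [gcdp p a] is constant, a divisibility of [a * b] passes to [b]; otherwise that gcd is
    associate to [p], which then divides [a]. *)
Lemma factorial_poly_field (F : fieldType) : is_factorial {poly F}.
Proof.
move=> p; have [n] := ubnP (size p); elim: n p => // n IH p; rewrite ltnS => sp /eqP nzp.
have [s1|ns1] := eqVneq (size p) 1%N.
  exists p, 1; split; [|exact: product_of1|by rewrite mulr1].
  apply/is_unitP; rewrite poly_unitE s1 eqxx /= unitfE.
  by have := lead_coef_eq0 p; rewrite /lead_coef s1 /= (negPf nzp) => ->.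
have [[d [dp d1 ddp]]|H] := classic (exists d, [/\ d %| p, size d != 1%N & (size d < size p)%N]).
  have pE := divpK dp; set e := p %/ d in pE.
  have nze : e != 0 by apply: contraNneq nzp => e0; rewrite -pE e0 mul0r.
  have nzd : d != 0 by apply: contraNneq nzp => d0; rewrite -pE d0 mulr0.
  have se : (size e < size p)%N.
    rewrite -pE size_mul //.
    have : (1 < size d)%N by rewrite ltn_neqAle eq_sym d1 size_poly_gt0.
    by move: (size d) (size e) => k l; lia.
  have [|u [c [uu Pc eE]]] := IH e (leq_trans se sp); first exact/eqP.
  have [|v [c' [uv Pc' dE]]] := IH d (leq_trans ddp sp); first exact/eqP.
  exists (u * v), (c * c'); split; [exact: is_unitM|exact: product_ofM|].
  by rewrite mulrACA -eE -dE pE.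
exists 1, p; split; [by exists 1; rewrite mulr1 | apply: product_of_single | by rewrite mul1r].
have dvdE q : divides p q <-> p %| q.
  split=> [[c ->]|/dvdpP [c ->]]; first by rewrite dvdp_mulr.
  by exists c; rewrite mulrC.
split; first exact/eqP.
split; first by move/is_unitP; rewrite poly_unitE (negPf ns1).
move=> a b /dvdE pab; have [g1|ng1] := eqVneq (size (gcdp p a)) 1%N.
  by right; apply/dvdE; rewrite -(@Gauss_dvdpr _ b a p) // /coprimep g1.
left; apply/dvdE; apply: NNPP => npa; apply: H; exists (gcdp p a); split=> //.
  exact: dvdp_gcdl.
rewrite ltn_neqAle (dvdp_leq nzp (dvdp_gcdl _ _)) andbT; apply/negP => /eqP sE.
apply: npa; have := dvdp_size_eqp (dvdp_gcdl p a); rewrite sE eqxx => /esym.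
by move=> /eqp_dvdl <-; apply: dvdp_gcdr.
Qed.

Lemma divides_polyC (R : comNzRingType) (p : R) (x : {poly R}) :
  divides p%:P x <-> forall i, divides p x`_i.
Proof.
split=> [[c ->] i|]; first by exists c`_i; rewrite coefCM.
elim/poly_ind: x => [_|x c IH H]; first by exists 0; rewrite mulr0.
have [|y ->] := IH; first by move=> i; have := H i.+1; rewrite coefD coefMX coefC addr0.
have [d] := H 0%N; rewrite coefD coefMX coefC add0r => ->.
by exists (y * 'X + d%:P); rewrite mulrDr mulrA polyCM.
Qed.

Lemma divides_polyC_MXaddC (R : comNzRingType) (p c : R) (x : {poly R}) :
  divides p%:P (x * 'X + c%:P) <-> divides p%:P x /\ divides p c.
Proof.
split=> [/divides_polyC H|[/divides_polyC Hx Hc]].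
  split; last by have := H 0%N; rewrite coefD coefMX coefC add0r.
  by apply/divides_polyC => i; have := H i.+1; rewrite coefD coefMX coefC addr0.
apply/divides_polyC => -[|i]; rewrite coefD coefMX coefC ?add0r ?addr0 //.
Qed.

(** Lowest coefficients are stripped from [x] as long as [p] divides them. Once one is not
    divisible, the lowest coefficient of the product forces [p] to divide that of [y], and so on
    through all of [y]. *)
Lemma prime_polyC (R : comNzRingType) (p : R) :
  is_prime_elt p -> is_prime_elt (p%:P : {poly R}).
Proof.
move=> [nzp [nup pr]]; split; first by move/polyC_inj.
split.
  move=> [q Hq]; apply: nup; exists q`_0; by rewrite -coefCM Hq coef1.
have MX (x : {poly R}) : divides p%:P (x * 'X) <-> divides p%:P x.
  have := divides_polyC_MXaddC p 0 x; rewrite addr0 => ->; split=> [[]//|H].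
  by split=> //; exists 0; rewrite mulr0.
move=> x; elim/poly_ind: x => [y _|x c IHx y Hxy]; first by left; exists 0; rewrite mulr0.
have [pc|npc] := classic (divides p c).
  rewrite divides_polyC_MXaddC.
  have [||] := IHx y; [|by left|by right].
  apply/MX; case: pc Hxy => d -> Hxy; rewrite polyCM in Hxy.
  have -> : x * y * 'X = (x * 'X + p%:P * d%:P) * y + p%:P * (- d%:P * y) by ring.
  by apply: dividesD => //; exists (- d%:P * y).
right; elim/poly_ind: y Hxy => [_|y d IHy Hxy]; first by exists 0; rewrite mulr0.
have pd : divides p d.
  have /(_ 0%N) := (divides_polyC _ _).1 Hxy; rewrite coef0M !coefD !coefMX !coefC !add0r.
  by case/pr.
apply/divides_polyC_MXaddC; split=> //; apply: IHy; apply/MX.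
case: pd Hxy => e ->; rewrite polyCM => Hxy; set z := x * 'X + c%:P in Hxy *.
have -> : z * y * 'X = z * (y * 'X + p%:P * e%:P) + p%:P * (- e%:P * z) by ring.
by apply: dividesD => //; exists (- e%:P * z).
Qed.

(** * Fractions and common denominators *)

Lemma fractionP (R : idomainType) (z : {fraction R}) :
  exists x y : R, y != 0 /\ z = tofrac x / tofrac y.
Proof.
elim/quotP: z => x _; exists (\n_x), (\d_x); split; first exact: denom_ratioP.
have nzd : tofrac (\d_x) != 0 by rewrite tofrac_eq0 denom_ratioP.
apply: (mulIf nzd); rewrite divfK //; unlock tofrac; rewrite -[LHS]FracField.pi_mul.
apply/eqmodP => /=; rewrite FracField.equivfE /FracField.mulf.
by rewrite !numden_Ratio ?oner_eq0 ?mulr1 ?mulf_neq0 ?denom_ratioP // mulrC.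
Qed.

Lemma tofrac_inj (R : idomainType) : injective (@tofrac R).
Proof. by move=> x y /eqP; rewrite tofrac_eq => /eqP. Qed.

Lemma map_mpoly_inj (n : nat) (R S : nzRingType) (f : {rmorphism R -> S}) :
  injective f -> injective (map_mpoly (n := n) f).
Proof.
move=> inj x y E; apply/mpolyP => m; apply: inj.
by rewrite -!mcoeff_map_mpoly E.
Qed.

Lemma common_denominator (R : idomainType) (s : seq {fraction R}) :
  exists2 c : R, c != 0 & forall z, z \in s -> exists x, tofrac c * z = tofrac x.
Proof.
elim: s => [|z s [c nzc IH]]; first by exists 1; rewrite ?oner_neq0.
have [x [y [nzy ->]]] := fractionP z; exists (y * c); first by rewrite mulf_neq0.
move=> w; rewrite inE => /orP[/eqP->|/IH [t Ht]]; rewrite tofracM.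
  exists (c * x); rewrite tofracM mulrAC mulrCA mulfV ?tofrac_eq0 // mulr1 //.
  by rewrite mulrC.
by exists (y * t); rewrite tofracM -Ht mulrA.
Qed.

(** Nagata's criterion replaces the usual argument with contents: inverting the primes of [K] leads
    to [{poly {fraction K}}], which is factorial by the case of a field. *)
Lemma factorial_poly (K : idomainType) :
  is_noetherian K -> is_factorial K -> is_factorial {poly K}.
Proof.
move=> noe fac.
pose j : {rmorphism {poly K} -> {poly {fraction K}}} := map_poly (@tofrac K).
pose P (q : {poly K}) := exists2 p : K, is_prime_elt p & q = p%:P.
apply: (@factorial_localization _ _ j P).
- exact: is_domain_idomain.
- exact: is_domain_idomain.
- exact: noetherian_poly.
- by apply: map_inj_poly; [exact: tofrac_inj | exact: tofrac0].
- by move=> _ [p pp ->]; apply: prime_polyC.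
- move=> _ [p [/eqP nzp _] ->]; rewrite /= map_polyC; exists ((tofrac p)^-1)%:P.
  by rewrite -polyCM mulfV ?tofrac_eq0.
- move=> e; have [c nzc cP] := common_denominator e.
  have [x Hx] : exists x, (tofrac c)%:P * e = j x.
    elim/poly_ind: e cP => [_|e d IH H]; first by exists 0; rewrite mulr0 rmorph0.
    have [nze|/negPn/eqP e0] := boolP (e != 0); last first.
      rewrite e0 mul0r add0r; have [->|nzd] := eqVneq d 0; first by exists 0; rewrite mulr0 rmorph0.
      have [|y Hy] := H d; first by rewrite e0 mul0r add0r polyseqC nzd inE.
      by exists y%:P; rewrite -polyCM Hy /= map_polyC.
    have sE : e * 'X + d%:P = d :: e :> seq _ by rewrite -cons_poly_def polyseq_cons nil_poly nze.
    have [|x Hx] := IH; first by move=> z Hz; apply: H; rewrite sE inE Hz orbT.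
    have [|y Hy] := H d; first by rewrite sE inE eqxx.
    exists (x * 'X + y%:P); rewrite rmorphD rmorphM /= map_polyX map_polyC /= -Hy polyCM.
    by rewrite -[map_poly _ _]/(j x) -Hx mulrDr mulrA.
  (* The denominator has to be a literal product of primes of [K], so the unit [u] of its
     factorization moves to the numerator through its inverse [v]. *)
  have [u [d [uu [s [Hs ->]] cE]]] := fac c (elimN eqP nzc).
  have [v Hv] := uu; exists (\prod_(q <- map polyC s) q), (v%:P * x); split.
    exists (map polyC s); split=> // q /mapP [r /Hs pr ->]; by exists r.
  rewrite big_map -(rmorph_prod polyC) rmorphM -Hx cE tofracM /= !map_polyC /=.
  by rewrite polyCM mulrA [_ * (_ * (tofrac _)%:P)]mulrA -polyCM -tofracM [v * u]mulrC Hv tofrac1 mul1r.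
- exact: factorial_poly_field.
Qed.

(** * Transport along isomorphisms and polynomial rings in several variables *)

Lemma bijective_inverse (R S : comPzRingType) (f : {rmorphism R -> S}) :
  injective f -> (forall y, exists x, f x = y) ->
  exists g : {rmorphism S -> R}, cancel f g /\ cancel g f.
Proof.
move=> inj surj.
have sb y : exists x, f x == y by have [x <-] := surj y; exists x.
pose g y := xchoose (sb y).
have gK : cancel g f by move=> y; apply/eqP/(xchooseP (sb y)).
have fK : cancel f g by move=> x; apply: inj; rewrite gK.
have gadd : zmod_morphism g by move=> x y; apply: inj; rewrite rmorphB !gK.
have gmul : monoid_morphism g.
  by split=> [|x y]; apply: inj; rewrite ?rmorphM ?rmorph1 !gK.
pose ga := GRing.isZmodMorphism.Build _ _ g gadd.
pose gm := GRing.isMonoidMorphism.Build _ _ g gmul.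
pose gg : {rmorphism S -> R} := HB.pack g ga gm.
by exists gg.
Qed.

Lemma divides_inj (R S : comPzRingType) (f : {rmorphism R -> S}) (g : {rmorphism S -> R}) :
  cancel f g -> cancel g f -> forall x y, divides (f x) (f y) <-> divides x y.
Proof.
move=> fK gK x y; split=> [[c Hc]|[c ->]]; last by exists (f c); rewrite rmorphM.
by exists (g c); rewrite -(fK y) Hc rmorphM fK.
Qed.

Lemma prime_iso (R S : comPzRingType) (f : {rmorphism R -> S}) (g : {rmorphism S -> R}) :
  cancel f g -> cancel g f -> forall x, is_prime_elt x -> is_prime_elt (f x).
Proof.
move=> fK gK x [nzx [nux pr]]; split.
  by move=> H; apply: nzx; rewrite -(fK x) H rmorph0.
split; first by move=> [c Hc]; apply: nux; exists (g c); rewrite -{1}(fK x) -rmorphM Hc rmorph1.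
move=> a b; rewrite -(gK a) -(gK b) -rmorphM => /(divides_inj fK gK) /pr.
by case=> H; [left|right]; apply/(divides_inj fK gK).
Qed.

Lemma factorial_iso (R S : comPzRingType) (f : {rmorphism R -> S}) (g : {rmorphism S -> R}) :
  cancel f g -> cancel g f -> is_factorial R -> is_factorial S.
Proof.
move=> fK gK fac x nzx; have [|u [c [[v uv] [s [Hs ->]] gx]]] := fac (g x).
  by move=> gx0; apply: nzx; rewrite -(gK x) gx0 rmorph0.
exists (f u), (\prod_(r <- map f s) r); split.
- by exists (f v); rewrite -rmorphM uv rmorph1.
- by exists (map f s); split=> // r /mapP [q /Hs pq ->]; apply: prime_iso pq.
- by rewrite big_map -(gK x) gx rmorphM rmorph_prod.
Qed.

(** [muni] splits off the last variable; substituting ['X_ord_max] back is a left inverse, hence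
    injectivity. The clause on constants lets primes of [R] be followed through an induction on the
    number of variables. *)
Lemma muni_iso (n : nat) (R : comNzRingType) :
  exists (f : {rmorphism {poly {mpoly R[n]}} -> {mpoly R[n.+1]}})
    (g : {rmorphism {mpoly R[n.+1]} -> {poly {mpoly R[n]}}}),
  [/\ cancel f g, cancel g f & forall c, f (c%:MP)%:P = c%:MP].
Proof.
have muniX : muni ('X_ord_max : {mpoly R[n.+1]}) = 'X.
  rewrite muniE msuppX big_seq1 mcoeffX eqxx scale1r mnm1E eqxx expr1.
  rewrite -[RHS]scale1r -mpolyX0; congr ('X_[_] *: _).
  apply/mnmP => i; rewrite mnmE mnm1E mnm0E; case: eqP => // /(congr1 val) /= E.
  by have := ltn_ord i; rewrite -E ltnn.
have muniW (q : {mpoly R[n]}) : muni (mwiden q) = q%:P.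
  elim/mpolyind: q => [|c m q _ _ IH]; first by rewrite !rmorph0.
  rewrite !rmorphD /= IH mwidenZ muniZ mwidenX; congr (_ + _).
  rewrite muniE msuppX big_seq1 mcoeffX eqxx scale1r mnmwiden_ordmax expr0.
  rewrite -mul_mpolyC polyCM -!mul_polyC; congr (_ * _); rewrite mulr1.
  by congr ('X_[_])%:P; apply/mnmP => i; rewrite mnmE mnmwiden_widen.
have surj (q : {poly {mpoly R[n]}}) : exists p : {mpoly R[n.+1]}, muni p = q.
  elim/poly_ind: q => [|q c [p <-]]; first by exists 0; rewrite rmorph0.
  by exists (p * 'X_ord_max + mwiden c); rewrite rmorphD rmorphM /= muniX muniW.
pose G (q : {poly {mpoly R[n]}}) : {mpoly R[n.+1]} := (map_poly (@mwiden n R) q).['X_ord_max].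
have muniK : cancel (@muni n R) G.
  move=> p; rewrite muniE /G rmorph_sum horner_sum [RHS]mpolyE; apply: eq_bigr => m _.
  rewrite -mul_polyC rmorphM /= map_polyXn map_polyC.
  rewrite hornerCM hornerXn /= mwidenZ mwidenX.
  rewrite -scalerAl mpolyXn -mpolyXD; congr (_ *: 'X_[_]); apply/mnmP => i.
  rewrite mnmDE mulmnE mnm1E; have [j ->|->] := unliftP ord_max i.
    have -> : lift ord_max j = widen_ord (leqnSn n) j.
      by apply: val_inj; rewrite /= /bump leqNgt ltn_ord.
    rewrite mnmwiden_widen mnmE; case: eqP => [/(congr1 val) /= E|]; last by rewrite mul0n addn0.
    by have := ltn_ord j; rewrite -E ltnn.
  by rewrite mnmwiden_ordmax eqxx mul1n.
pose mu : {rmorphism {mpoly R[n.+1]} -> {poly {mpoly R[n]}}} := @muni n R.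
have [f [gK fK]] := bijective_inverse (can_inj muniK : injective mu) surj.
by exists f, mu; split=> // c; rewrite -[RHS]gK /= muniC.
Qed.

Lemma mpoly0_iso (R : comNzRingType) :
  exists f : {rmorphism {mpoly R[0]} -> R},
    cancel (@mpolyC 0 R) f /\ cancel f (@mpolyC 0 R).
Proof.
have inj : injective (@mpolyC 0 R) by move=> x y /eqP; rewrite mpolyC_eq => /eqP.
have surj (y : {mpoly R[0]}) : exists x, x%:MP = y by exists (y@_0%MM); rewrite -nvar0_mpolyC.
pose c0 : {rmorphism R -> {mpoly R[0]}} := @mpolyC 0 R.
by have [f [fK gK]] := bijective_inverse (inj : injective c0) surj; exists f.
Qed.

Lemma prime_mpolyC (R : comNzRingType) (n : nat) (p : R) :
  is_prime_elt p -> is_prime_elt (p%:MP_[n]).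
Proof.
move=> pp; elim: n => [|n IH].
  have [f [fK gK]] := mpoly0_iso R.
  pose c0 : {rmorphism R -> {mpoly R[0]}} := @mpolyC 0 R.
  exact: (prime_iso (f := c0) fK gK pp).
have [f [g [fK gK fC]]] := muni_iso n R.
by rewrite -fC; apply: prime_iso fK gK _ _; apply: prime_polyC.
Qed.

Lemma noetherian_mpoly (R : comNzRingType) (n : nat) :
  is_noetherian R -> is_noetherian {mpoly R[n]}.
Proof.
move=> noe; elim: n => [|n IH].
  have [f [_ gK]] := mpoly0_iso R.
  pose c0 : {rmorphism R -> {mpoly R[0]}} := @mpolyC 0 R.
  by apply: (@noetherian_surj _ _ c0) noe => y; exists (f y); apply: gK.
have [f [g [_ gK _]]] := muni_iso n R.
by apply: (@noetherian_surj _ _ f) (noetherian_poly IH) => y; exists (g y).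
Qed.

Lemma factorial_mpoly (K : idomainType) (n : nat) :
  is_noetherian K -> is_factorial K -> is_factorial {mpoly K[n]}.
Proof.
move=> noe fac; elim: n => [|n IH].
  have [f [fK gK]] := mpoly0_iso K.
  pose c0 : {rmorphism K -> {mpoly K[0]}} := @mpolyC 0 K.
  exact: (factorial_iso (f := c0) fK gK fac).
have [f [g [fK gK _]]] := muni_iso n K.
by apply: (factorial_iso fK gK); apply: factorial_poly => //; apply: noetherian_mpoly.
Qed.

Lemma factorial_field (F : fieldType) : is_factorial F.
Proof.
move=> x /eqP nzx; exists x, 1; split; [|exact: product_of1|by rewrite mulr1].
by exists x^-1; rewrite mulfV.
Qed.

(** * Binomial ideals *)

(** The relations are numbered from 1, whence the shift. Coefficients are indexed by [nat], so that
    relations can be adjoined one at a time without changing the index set. *)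
Definition ideal_upto (R : comPzRingType) (r : nat -> R) (m : nat) (x : R) : Prop :=
  exists c : nat -> R, x = \sum_(i < m) c i * r i.+1.

Lemma is_ideal_upto (R : comPzRingType) (r : nat -> R) (m : nat) :
  is_ideal (ideal_upto r m).
Proof.
split; first by exists (fun => 0); rewrite big1 // => i _; rewrite mul0r.
split=> [x y [c ->] [d ->] | s x [c ->]].
  by exists (fun i => c i + d i); rewrite -big_split; apply: eq_bigr => i _; rewrite mulrDl.
by exists (fun i => s * c i); rewrite mulr_sumr; apply: eq_bigr => i _; rewrite mulrA.
Qed.

Lemma ideal_upto_min (R : comPzRingType) (r : nat -> R) (m : nat) (I : R -> Prop) :
  is_ideal I -> (forall i, (1 <= i <= m)%N -> I (r i)) ->
  forall x, ideal_upto r m x -> I x.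
Proof.
move=> [I0 [ID IM]] Hr x [c ->]; elim/big_ind: _ => [//|//|i _].
by apply/IM/Hr; rewrite ltn_ord.
Qed.

Lemma ideal_uptoS (R : comPzRingType) (r : nat -> R) (m : nat) (x : R) :
  ideal_upto r m.+1 x <-> exists c, ideal_upto r m (x - c * r m.+1).
Proof.
split=> [[c ->]|[d [c Hc]]]; first by exists (c m), c; rewrite big_ord_recr addrK.
exists (fun i => if i == m then d else c i); rewrite big_ord_recr /= eqxx.
rewrite -[x](subrK (d * r m.+1)) Hc; congr (_ + _); apply: eq_bigr => i _.
by rewrite ltn_eqF.
Qed.

Lemma mem_ideal_upto (R : comPzRingType) (r : nat -> R) (m i : nat) :
  (1 <= i <= m)%N -> ideal_upto r m (r i).
Proof.
elim: m => [|m IH]; first by case: i.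
move=> /andP[i0]; rewrite leq_eqVlt => /orP[/eqP->|lt_im]; apply/ideal_uptoS.
  by exists 1; rewrite mul1r subrr; case: (is_ideal_upto r m).
by exists 0; rewrite mul0r subr0; apply: IH; rewrite i0.
Qed.

Definition ideal_add (R : comPzRingType) (I : R -> Prop) (p x : R) : Prop :=
  exists y, I (x - p * y).

Lemma is_ideal_add (R : comPzRingType) (I : R -> Prop) (p : R) :
  is_ideal I -> is_ideal (ideal_add I p).
Proof.
move=> [I0 [ID IM]]; split; first by exists 0; rewrite mulr0 subr0.
split=> [x y [c Hc] [d Hd]|r x [c Hc]].
  exists (c + d); have -> : x + y - p * (c + d) = (x - p * c) + (y - p * d) by ring.
  exact: ID.
exists (r * c); have -> : r * x - p * (r * c) = r * (x - p * c) by ring.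
exact: IM.
Qed.

(** The degrees of the [Z_j], [j <= m], that make binomials 1 to [m] homogeneous, as [weight_rec]
    expresses. They also serve as the exponents of the monomial curve below. *)
Definition weight (a b : nat -> nat) (m j : nat) : nat :=
  \prod_(1 <= t < j.+1) b t * \prod_(j.+1 <= t < m.+1) a t.

Lemma weightS (a b : nat -> nat) (m j : nat) :
  (j <= m)%N -> weight a b m.+1 j = (a m.+1 * weight a b m j)%N.
Proof.
by move=> le_jm; rewrite /weight [X in (_ * X)%N]big_nat_recr //= [RHS]mulnC mulnA.
Qed.

Lemma weight_diag (a b : nat -> nat) (m : nat) :
  weight a b m m = (\prod_(1 <= t < m.+1) b t)%N.
Proof. by rewrite /weight [X in (_ * X)%N]big_geq // muln1. Qed.

Lemma weight_rec (a b : nat -> nat) (m j : nat) :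
  (j < m)%N -> (a j.+1 * weight a b m j.+1 = b j.+1 * weight a b m j)%N.
Proof.
move=> lt_jm; rewrite /weight [X in (_ = b _ * (_ * X))%N]big_ltn ?ltnS //.
rewrite [X in (_ * (X * _))%N]big_nat_recr //=; lia.
Qed.

(** Modulo [a m.+1] all weights but the last vanish, and the last is coprime to [a m.+1]. So the sum
    determines the last exponent modulo [a m.+1], and the bound determines it outright; the rest is
    divided by [a m.+1]. Index 0 needs no bound, since for [m = 0] its weight is 1. *)
Lemma weight_inj (a b : nat -> nat) (m : nat) (e e' : nat -> nat) :
  (forall i, (1 <= i <= m)%N -> coprime (a i) (\prod_(1 <= t < i.+1) b t)) ->
  (forall i, (1 <= i <= m)%N -> (e i < a i)%N) ->
  (forall i, (1 <= i <= m)%N -> (e' i < a i)%N) ->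
  (\sum_(0 <= j < m.+1) weight a b m j * e j = \sum_(0 <= j < m.+1) weight a b m j * e' j)%N ->
  forall j, (j <= m)%N -> e j = e' j.
Proof.
elim: m => [|m IH] co lt_e lt_e'.
  rewrite !big_nat1 weight_diag big_geq // !mul1n => E j.
  by rewrite leqn0 => /eqP->.
have sumE f : (\sum_(0 <= j < m.+2) weight a b m.+1 j * f j = a m.+1 *
    (\sum_(0 <= j < m.+1) weight a b m j * f j) + \prod_(1 <= t < m.+2) b t * f m.+1)%N.
  rewrite big_nat_recr //= weight_diag big_distrr; congr addn.
  by apply: eq_big_nat => j /andP[_ lt_j]; rewrite weightS // -mulnA.
have rng : (0 < m.+1 <= m.+1)%N by rewrite leqnn.
rewrite !sumE => E; have last_eq : e m.+1 = e' m.+1.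
  have : (e m.+1 = e' m.+1 %[mod a m.+1])%N.
    have Em := congr1 (modn^~ (a m.+1)) E.
    move: Em; rewrite /= ![(a m.+1 * _)%N]mulnC !modnMDl.
    have key B x y : coprime (a m.+1) B -> (y <= x)%N ->
        (B * x = B * y %[mod a m.+1])%N -> (x = y %[mod a m.+1])%N.
      move=> coB le_yx /eqP H; apply/eqP; move: H.
      by rewrite eqn_mod_dvd ?leq_mul2l ?le_yx ?orbT // -mulnBr Gauss_dvdr // eqn_mod_dvd.
    have [|/ltnW] := leqP (e' m.+1) (e m.+1) => [/key H|/key H E']; first by apply/H/co.
    by symmetry; apply: (H _ (co _ rng)).
  by rewrite !modn_small ?lt_e ?lt_e'.
have apos : (0 < a m.+1)%N by apply: leq_ltn_trans (lt_e _ rng).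
move: E; rewrite last_eq => /addIn /eqP; rewrite eqn_pmul2l // => /eqP E j.
rewrite leq_eqVlt => /orP[/eqP->//|]; rewrite ltnS; apply: IH => // i /andP[i0 im].
- by apply: co; rewrite i0 (leq_trans im).
- by apply: lt_e; rewrite i0 (leq_trans im).
- by apply: lt_e'; rewrite i0 (leq_trans im).
Qed.

(* The scaling [c i -> c i * t ^+ weight i] preserves the first [m] equations,
   and coprimality lets one choose [t] so that the next one becomes solvable. *)
Lemma unit_point (K : comUnitRingType) (u v : nat -> K) (a b : nat -> nat) (m : nat) :
  (forall i, (1 <= i <= m)%N -> u i \is a GRing.unit) ->
  (forall i, (1 <= i <= m)%N -> v i \is a GRing.unit) ->
  (forall i, (1 <= i <= m)%N -> (0 < a i)%N) ->
  (forall i, (1 <= i <= m)%N -> coprime (a i) (\prod_(1 <= t < i.+1) b t)) ->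
  exists c : nat -> K, (forall i, c i \is a GRing.unit) /\
    forall i, (i < m)%N -> u i.+1 * c i.+1 ^+ a i.+1 + v i.+1 * c i ^+ b i.+1 = 0.
Proof.
elim: m => [|m IH] Hu Hv Ha Hco; first by exists (fun => 1); split=> // i; rewrite unitr1.
have W i : (0 < i <= m)%N -> (0 < i <= m.+1)%N by case/andP=> -> /leqW.
have [|||| c [uc Hc]] := IH; [by move=> i /W; auto..|].
have rng : (0 < m.+1 <= m.+1)%N by rewrite leqnn.
pose d := - v m.+1 / u m.+1 * c m ^+ b m.+1.
have ud : d \is a GRing.unit by rewrite !unitrM unitrN unitrV Hu ?Hv ?unitrX.
(* Here [d] is the value that the new equation demands for the [a m.+1]-th power of the new
   coordinate. With [B] the product of the [b t], Bezout gives [y * a m.+1 = x * B + 1]; scaling by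
   [d ^+ x] turns the demand into [d * d ^+ (x * B)], the [a m.+1]-th power of [d ^+ y]. *)
case: (egcdnP (\prod_(1 <= t < m.+2) b t)%N (Ha _ rng)) => y x.
move: (Hco _ rng); rewrite /coprime => /eqP -> E _.
exists (fun i => if i == m.+1 then d ^+ y else c i * (d ^+ x) ^+ weight a b m i); split.
  by move=> i; case: ifP => _; rewrite ?unitrM ?unitrX ?uc ?ud // unitrX.
move=> i; rewrite ltnS leq_eqVlt => /orP[/eqP->|lt_im].
  rewrite eqxx ltn_eqF // weight_diag.
  have ud' : u m.+1 * d = - (v m.+1 * c m ^+ b m.+1).
    by rewrite /d [u _ * _]mulrA mulrCA divrr ?Hu // mulr1 mulNr.
  have E' : (y * a m.+1 = (x * \prod_(1 <= t < m.+1) b t * b m.+1).+1)%N.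
    by rewrite E big_nat_recr //= addn1 mulnA.
  clearbody d; rewrite -[d ^+ y ^+ _]exprM E' exprS exprMn -!exprM mulrA ud' mulNr mulrA.
  by rewrite addNr.
rewrite !ltn_eqF ?ltnS ?(ltnW lt_im) //; set t := d ^+ x.
rewrite !exprMn -!(exprM t) [(weight _ _ _ i.+1 * _)%N]mulnC weight_rec // mulnC.
by rewrite !mulrA -mulrDl Hc // mul0r.
Qed.

(** * Monomial maps and reduction modulo the binomials *)

Lemma divides_mpolyC (R : comNzRingType) (n : nat) (p : R) (x : {mpoly R[n]}) :
  divides p%:MP x <-> forall M, divides p x@_M.
Proof.
split=> [[c ->] M|H]; first by exists c@_M; rewrite mcoeffCM.
rewrite [x]mpolyE; elim/big_ind: _ => [||M _].
- by exists 0; rewrite mulr0.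
- by move=> y z; apply: dividesD.
- by have [c ->] := H M; exists (c *: 'X_[M]); rewrite mul_mpolyC scalerA.
Qed.

Lemma mmap1_monomials (R : comNzRingType) (n k : nat) (h : 'I_n -> {mpoly R[k]})
    (kappa : 'I_n -> R) (tau : 'I_n -> 'X_{1..k}) (M : 'X_{1..n}) :
  (forall j, h j = kappa j *: 'X_[tau j]) ->
  mmap1 h M = (\prod_j kappa j ^+ M j) *: 'X_[(\sum_j tau j *+ M j)%MM].
Proof.
move=> hE; rewrite /mmap1 (eq_bigr (fun j => (kappa j ^+ M j) *: 'X_[(tau j *+ M j)%MM])).
  by rewrite scaler_prod mprodXE.
by move=> j _; rewrite hE exprZn mpolyXn.
Qed.

(** As the monomials of the support have distinct images, each coefficient of [P] reappears in the
    image at a monomial of its own, multiplied by a unit. *)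
Lemma divides_monomial_map (R : comUnitRingType) (n k : nat) (h : 'I_n -> {mpoly R[k]})
    (kappa : 'I_n -> R) (tau : 'I_n -> 'X_{1..k}) (p : R) (P : {mpoly R[n]}) :
  (forall j, h j = kappa j *: 'X_[tau j]) -> (forall j, kappa j \is a GRing.unit) ->
  {in msupp P &, injective (fun M : 'X_{1..n} => \sum_j tau j *+ M j)%MM} ->
  divides p%:MP (mmap (@mpolyC k R) h P) -> divides p%:MP P.
Proof.
move=> hE uk inj /divides_mpolyC H; apply/divides_mpolyC => M0.
have [M0P|/memN_msupp_eq0 ->] := boolP (M0 \in msupp P); last by exists 0; rewrite mulr0.
set th := fun M : 'X_{1..n} => (\sum_j tau j *+ M j)%MM in inj.
have hM M : mmap1 h M = (\prod_j kappa j ^+ M j) *: 'X_[th M] by apply: mmap1_monomials.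
have := H (th M0); rewrite /mmap raddf_sum /= (bigD1_seq M0) //=.
rewrite big1_seq ?addr0 => [|M /andP[neM MP]].
  rewrite mcoeffCM hM mcoeffZ mcoeffX eqxx mulr1 mulrC.
  apply: divides_unit_mul; apply/is_unitP/rpred_prod => j _; exact: unitrX.
rewrite mcoeffCM hM mcoeffZ mcoeffX.
by case: eqP => [/inj E|]; rewrite ?mulr0 //; case/eqP: neM; apply: E.
Qed.

(** What remains of [gen_rel] modulo a prime dividing [f i]. *)
Definition binomial_rel (K : comNzRingType) (N : nat) (u v : nat -> K) (a b : nat -> nat)
    (i : nat) : {mpoly K[N.+1]} :=
  (u i)%:MP * 'X_(inord i) ^+ a i + (v i)%:MP * 'X_(inord i.-1) ^+ b i.

Lemma ideal_mod_exp (R : comPzRingType) (I : R -> Prop) (x y : R) (q : nat) :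
  is_ideal I -> I (x - y) -> I (x ^+ q - y ^+ q).
Proof. by move=> [_ [_ IM]] Ixy; rewrite subrXX mulrC; apply: IM. Qed.

Definition reduced (N : nat) (a : nat -> nat) (l m : nat) (M : 'X_{1..N.+1}) : Prop :=
  forall i, (l <= i <= m)%N -> (M (inord i) < a i)%N.

(** Binomial [i] trades [Z_i ^+ a i] for a scalar multiple of [Z_{i-1} ^+ b i], which raises only
    the exponent of index [i-1]. Treating the indices in the order [m], ..., 1 therefore leaves
    those already reduced untouched. *)
Lemma reduce_monomial (K : comUnitRingType) (N : nat) (u v : nat -> K) (a b : nat -> nat)
    (m : nat) (M : 'X_{1..N.+1}) :
  (m <= N)%N -> (forall i, (1 <= i <= m)%N -> u i \is a GRing.unit) ->
  (forall i, (1 <= i <= m)%N -> (0 < a i)%N) ->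
  exists e M', reduced a 1 m M' /\
    ideal_upto (@binomial_rel K N u v a b) m ('X_[M] - e *: 'X_[M']).
Proof.
move=> le_mN Hu Ha; set I := ideal_upto _ m.
have idI : is_ideal I by apply: is_ideal_upto.
have [I0 [ID IM]] := idI.
suff main l : (l <= m)%N -> exists e M', reduced a (m - l).+1 m M' /\ I ('X_[M] - e *: 'X_[M']).
  by have [] := main m (leqnn m); rewrite subnn => e [M' H]; exists e, M'.
elim: l => [_|l IH lt_lm].
  exists 1, M; rewrite scale1r subrr; split=> // i; rewrite subn0.
  by move=> /andP[lt /(leq_trans lt)]; rewrite ltnn.
have [e [M1 [red1 cong1]]] := IH (ltnW lt_lm).
pose i := (m - l)%N.
have i_rng : (0 < i <= m)%N by rewrite subn_gt0 lt_lm leq_subr.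
have [i0 im] := andP i_rng.
have -> : (m - l.+1).+1 = i by rewrite subnS prednK.
(* [q] counts the full powers [Z_i ^+ a i], each replaced by [b i] further factors [Z_{i-1}]; [M0]
   keeps the remainder modulo [a i]. *)
pose q := (M1 (inord i) %/ a i)%N.
pose M0 := (M1 - U_(inord i) *+ (q * a i))%MM.
pose M2 := (M0 + U_(inord i.-1) *+ (q * b i))%MM.
have M1E : M1 = (M0 + U_(inord i) *+ (q * a i))%MM.
  apply/mnmP => j; rewrite mnmDE mnmBE mulmnE mnm1E.
  by case: eqP => [<-|_]; rewrite ?mul0n ?subn0 ?addn0 // mul1n subnK // leq_trunc_div.
pose t := - v i / u i.
exists (e * t ^+ q), M2; split=> [j /andP[le_ij le_jm]|].
  have ltN k : (k <= m)%N -> (k < N.+1)%N by move=> H; rewrite ltnS (leq_trans H).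
  rewrite mnmDE mnmBE !mulmnE !mnm1E.
  have -> : (inord i.-1 == inord j :> 'I_N.+1) = false.
    apply/eqP => /(congr1 val) /=; rewrite !inordK ?ltN // => [E|]; last by apply: leq_trans im; apply: leq_pred.
    by move: le_ij; rewrite -E leqNgt prednK // leqnn.
  rewrite mul0n addn0; move: le_ij; rewrite leq_eqVlt => /orP[/eqP E|lt_ij].
    rewrite -E eqxx mul1n /q {1}(divn_eq (M1 (inord i)) (a i)) addKn.
    by rewrite ltn_mod Ha.
  have -> : (inord i == inord j :> 'I_N.+1) = false.
    apply/eqP => /(congr1 val) /=; rewrite !inordK ?ltN // => E.
    by move: lt_ij; rewrite E ltnn.
  by rewrite mul0n subn0; apply: red1; rewrite lt_ij.
have congZ : I ('X_(inord i) ^+ a i - t%:MP * 'X_(inord i.-1) ^+ b i).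
  have -> : 'X_(inord i) ^+ a i - t%:MP * 'X_(inord i.-1) ^+ b i
     = ((u i)^-1)%:MP * @binomial_rel K N u v a b i.
    rewrite /binomial_rel mulrDr !mulrA -!mpolyCM mulVr ?Hu // mpolyC1 mul1r.
    by rewrite /t mulNr mpolyCN mulNr opprK [v i / u i]mulrC.
  exact/IM/mem_ideal_upto.
clearbody t.
have tq : (t%:MP_[N.+1]) ^+ q = (t ^+ q)%:MP by rewrite rmorphXn.
have congq := ideal_mod_exp q idI congZ.
have -> : 'X_[M] - (e * t ^+ q) *: 'X_[M2] = ('X_[M] - e *: 'X_[M1])
    + (e *: 'X_[M0]) * (('X_(inord i) ^+ a i) ^+ q - (t%:MP * 'X_(inord i.-1) ^+ b i) ^+ q).
  rewrite mulrBr exprMn -!exprM M1E /M2 !mpolyXD -!mpolyXn -!scalerAl.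
  rewrite tq [(a i * q)%N]mulnC [(b i * q)%N]mulnC mulrCA mul_mpolyC.
  by rewrite scalerA addrA subrK.
by apply: ID => //; apply: IM.
Qed.

Lemma reduce_mpoly (K : comUnitRingType) (N : nat) (u v : nat -> K) (a b : nat -> nat)
    (m : nat) (P : {mpoly K[N.+1]}) :
  (m <= N)%N -> (forall i, (1 <= i <= m)%N -> u i \is a GRing.unit) ->
  (forall i, (1 <= i <= m)%N -> (0 < a i)%N) ->
  exists P', (forall M, M \in msupp P' -> reduced a 1 m M) /\
    ideal_upto (@binomial_rel K N u v a b) m (P - P').
Proof.
move=> le_mN Hu Ha; have [I0 [ID IM]] := is_ideal_upto (@binomial_rel K N u v a b) m.
elim/mpolyind: P => [|c M P _ _ [P' [red cong]]].
  by exists 0; rewrite subrr; split=> // M; rewrite msupp0.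
have [e [M' [redM congM]]] := reduce_monomial v b M le_mN Hu Ha.
exists (c *: (e *: 'X_[M']) + P'); split=> [M1 /msuppD_le|].
  rewrite mem_cat => /orP[|/red //]; rewrite scalerA => /msuppZ_le.
  by rewrite msuppX inE => /eqP->.
have -> : c *: 'X_[M] + P - (c *: (e *: 'X_[M']) + P')
   = c%:MP * ('X_[M] - e *: 'X_[M']) + (P - P').
  by rewrite mul_mpolyC scalerBr opprD addrACA.
by apply: ID => //; apply: IM.
Qed.

(* Modulo the binomials every polynomial is reduced, and the weights keep the
   images of the reduced monomials under [chi] apart. *)
Lemma binomial_parametrization (K : comUnitRingType) (N : nat) (u v : nat -> K)
    (a b : nat -> nat) (m : nat) :
  (m <= N)%N ->
  (forall i, (1 <= i <= m)%N -> u i \is a GRing.unit) ->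
  (forall i, (1 <= i <= m)%N -> v i \is a GRing.unit) ->
  (forall i, (1 <= i <= m)%N -> (0 < a i)%N) ->
  (forall i, (1 <= i <= m)%N -> coprime (a i) (\prod_(1 <= t < i.+1) b t)) ->
  exists chi : {rmorphism {mpoly K[N.+1]} -> {mpoly K[N.+1]}},
  [/\ forall p P, ideal_add (ideal_upto (@binomial_rel K N u v a b) m) p%:MP P
                    <-> divides p%:MP (chi P),
      forall c, chi c%:MP = c%:MP,
      forall i, (m < i <= N)%N -> chi 'X_(inord i) = 'X_(inord i)
    & exists c d, chi 'X_(inord m) = c *: 'X_(inord 0) ^+ d].
Proof.
move=> le_mN Hu Hv Ha Hco; have [c [uc Hc]] := unit_point Hu Hv Ha Hco.
(* [chi] sends [Z_j] to [c j] times [Z_0] to the power [weight a b m j] for [j <= m], and fixes the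
   later variables; [Z_0] doubles as the parameter of the curve. The exponent of [Z_0] in the image
   of a monomial is thus its weighted degree. *)
pose kappa (j : 'I_N.+1) := if (j <= m)%N then c j else 1.
pose tau (j : 'I_N.+1) : 'X_{1..N.+1} :=
  if (j <= m)%N then (U_(inord 0) *+ weight a b m j)%MM else U_(j)%MM.
pose h j : {mpoly K[N.+1]} := kappa j *: 'X_[tau j].
pose chi : {rmorphism {mpoly K[N.+1]} -> {mpoly K[N.+1]}} := mmap (@mpolyC N.+1 K) h.
have chiC d : chi d%:MP = d%:MP by rewrite /chi /= mmapC.
have chiX j : chi 'X_j = h j by rewrite /chi /= mmapX mmap1U.
have le_S i : (i <= m)%N -> (i < N.+1)%N by move=> H; rewrite ltnS (leq_trans H).
have chi_le i : (i <= m)%N -> chi 'X_(inord i) = c i *: 'X_(inord 0) ^+ weight a b m i.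
  by move=> im; rewrite chiX /h /kappa /tau inordK ?le_S // im mpolyXn.
have inj_tau (M M' : 'X_{1..N.+1}) : reduced a 1 m M -> reduced a 1 m M' ->
    (\sum_j tau j *+ M j)%MM = (\sum_j tau j *+ M' j)%MM -> M = M'.
  move=> red red' E.
  have tau0 (L : 'X_{1..N.+1}) : ((\sum_j tau j *+ L j)%MM (inord 0)
      = \sum_(0 <= j < m.+1) weight a b m j * L (inord j))%N.
    rewrite mnm_sumE big_mkord (big_ord_widen N.+1 (fun j => weight a b m j * L (inord j))%N) //.
    rewrite [RHS]big_mkcond; apply: eq_bigr => j _; rewrite mulmnE /tau inord_val ltnS.
    case: leqP => [_|lt_mj]; first by rewrite mulmnE mnm1E eqxx mul1n.
    rewrite mnm1E; case: eqP => [/(congr1 val) /= E'|]; last by rewrite mul0n.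
    by move: lt_mj; rewrite E' inordK.
  have low i : (i <= m)%N -> M (inord i) = M' (inord i).
    apply: (weight_inj (e := fun i => M (inord i)) (e' := fun i => M' (inord i)) Hco red red').
    by rewrite -!tau0 E.
  apply/mnmP => j; have [jm|lt_mj] := leqP j m; first by rewrite -[j]inord_val low.
  have tauj (L : 'X_{1..N.+1}) : ((\sum_j tau j *+ L j)%MM j = L j)%N.
    rewrite mnm_sumE (bigD1 j) //= mulmnE /tau leqNgt lt_mj /= mnm1E eqxx mul1n.
    rewrite big1 ?addn0 // => k /negbTE kj; rewrite mulmnE.
    case: leqP => [_|_]; last by rewrite mnm1E kj.
    rewrite mulmnE mnm1E; case: eqP => [/(congr1 val) /= E'|]; last by rewrite !mul0n.
    by move: lt_mj; rewrite -E' inordK.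
  by rewrite -[LHS]tauj E tauj.
have rel0 i : (1 <= i <= m)%N -> chi (@binomial_rel K N u v a b i) = 0.
  case: i => // i /andP[_ lt_im]; rewrite /binomial_rel rmorphD !rmorphM !rmorphXn !chiC.
  rewrite !chi_le // ?(ltnW lt_im) // !exprZn !mul_mpolyC !scalerA -!exprM.
  rewrite [(weight _ _ _ i.+1 * _)%N]mulnC weight_rec // [(b _ * _)%N]mulnC.
  by rewrite -scalerDl Hc // scale0r.
have I0 P : ideal_upto (@binomial_rel K N u v a b) m P -> chi P = 0.
  move: P; apply: (ideal_upto_min (I := fun P => chi P = 0)) => //; split; first by rewrite rmorph0.
  by split=> [x y Hx Hy|r x Hx]; rewrite ?rmorphD ?rmorphM ?Hx ?Hy ?addr0 ?mulr0.
exists chi; split=> //.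
- move=> p P; split=> [[R /I0]|H].
    rewrite rmorphB rmorphM chiC => /eqP; rewrite subr_eq0 => /eqP ->.
    by exists (chi R).
  have [P' [redP' cong]] := reduce_mpoly v b P le_mN Hu Ha.
  suff [R P'E] : divides p%:MP P' by exists R; rewrite -P'E.
  apply: (@divides_monomial_map _ _ _ h kappa tau) => //.
  - by move=> j; rewrite /kappa; case: ifP; rewrite ?uc ?unitr1.
  - by move=> M M' /redP' HM /redP' HM'; apply: inj_tau.
  - by move: H; rewrite -[P](subrK P') rmorphD (I0 _ cong) add0r.
- move=> i /andP[lt_mi le_iN]; rewrite chiX /h /kappa /tau inordK ?ltnS //.
  by rewrite leqNgt lt_mi scale1r.
- by exists (c m), (weight a b m m); apply: chi_le.
Qed.

(** Primality is that of the constant [p] in a polynomial ring, pulled back along [chi]. The last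
    clause makes relation [m.+1] cancellable modulo [p] and the preceding relations. *)
Lemma binomial_ideal_prime (K : idomainType) (N : nat) (u v : nat -> K)
    (a b : nat -> nat) (m : nat) (p : K) :
  (m <= N)%N -> is_prime_elt p ->
  (forall i, (1 <= i <= m)%N -> u i \is a GRing.unit) ->
  (forall i, (1 <= i <= m)%N -> v i \is a GRing.unit) ->
  (forall i, (1 <= i <= m)%N -> (0 < a i)%N) ->
  (forall i, (1 <= i <= m)%N -> coprime (a i) (\prod_(1 <= t < i.+1) b t)) ->
  let J := ideal_add (ideal_upto (@binomial_rel K N u v a b) m) p%:MP in
  [/\ forall P Q, J (P * Q) -> J P \/ J Q,
      forall c, J c%:MP -> divides p c
    & (m < N)%N -> u m.+1 \is a GRing.unit -> (0 < a m.+1)%N ->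
        ~ J (@binomial_rel K N u v a b m.+1)].
Proof.
move=> le_mN pp Hu Hv Ha Hco.
have [chi [JE chiC chiX [c [d chim]]]] := binomial_parametrization le_mN Hu Hv Ha Hco.
have ppC := prime_mpolyC N.+1 pp; split.
- by move=> P Q /JE; rewrite rmorphM => H; case: ppC => _ [_ /(_ _ _ H)] [] /JE; auto.
- by move=> k /JE; rewrite chiC => /divides_mpolyC /(_ 0%MM); rewrite mcoeffC eqxx mulr1.
(* The image of binomial [m.+1] has coefficient [u m.+1] at the [a m.+1]-th power of variable
   [m.+1], since its other term only involves variable 0; divisibility would make [p] a unit. *)
move=> lt_mN um a0 /JE; rewrite /binomial_rel rmorphD !rmorphM !rmorphXn !chiC /= chim.
rewrite chiX ?ltnS ?leqnn // => /divides_mpolyC /(_ (U_(inord m.+1) *+ a m.+1)%MM).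
rewrite exprZn -exprM !mul_mpolyC scalerA mcoeffD !mcoeffZ !mcoeffXn eqxx mulr1.
case: eqP => [/mnmP/(_ (inord m.+1))|_].
  rewrite !mulmnE !mnm1E eqxx mul1n.
  case: eqP => [/(congr1 val) /=|_]; first by rewrite !inordK.
  by rewrite mul0n => E; move: a0; rewrite -E.
rewrite mulr0 addr0 => /is_unit_divides; case: pp => _ [nup _] H; apply: nup.
by apply/H/is_unitP.
Qed.

(* Modulo [p] the defining relations are binomial, whence [c] in the proof lies
   in the prime ideal generated by [p] and the first [m] relations. *)
Lemma torsion_free_upto (K : idomainType) (N n : nat) (u v f : nat -> K)
    (a b : nat -> nat) (p : K) (r : nat -> {mpoly K[N.+1]}) :
  (n <= N)%N -> is_prime_elt p ->
  (forall i, (1 <= i <= n)%N -> u i \is a GRing.unit) ->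
  (forall i, (1 <= i <= n)%N -> v i \is a GRing.unit) ->
  (forall i, (1 <= i <= n)%N -> (0 < a i)%N) ->
  (forall i, (1 <= i <= n)%N -> coprime (a i) (\prod_(1 <= t < i.+1) b t)) ->
  (forall i, (1 <= i <= n)%N -> exists s, r i = @binomial_rel K N u v a b i + p%:MP * s) ->
  [/\ forall P, ideal_upto r n (p%:MP * P) -> ideal_upto r n P,
      forall P Q, ideal_add (ideal_upto r n) p%:MP (P * Q) ->
        ideal_add (ideal_upto r n) p%:MP P \/ ideal_add (ideal_upto r n) p%:MP Q
    & forall c, ideal_add (ideal_upto r n) p%:MP c%:MP -> divides p c].
Proof.
move=> le_nN pp Hu Hv Ha Hco rE.
have W m : (m <= n)%N -> forall i, (0 < i <= m)%N -> (0 < i <= n)%N.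
  by move=> le_mn i /andP[-> /leq_trans -> ].
(* Each relation differs from its binomial by a multiple of [p], so both families generate the same
   ideal together with [p]. *)
have JE m P : (m <= n)%N -> ideal_add (ideal_upto r m) p%:MP P <->
    ideal_add (ideal_upto (@binomial_rel K N u v a b) m) p%:MP P.
  move=> le_mn; split=> -[y].
    have idJ := is_ideal_add p%:MP (is_ideal_upto (@binomial_rel K N u v a b) m).
    have [J0 [JD JM]] := idJ => H.
    rewrite -[P](subrK (p%:MP * y)); apply: JD; last first.
      by exists y; rewrite subrr; case: (is_ideal_upto (@binomial_rel K N u v a b) m).
    apply: ideal_upto_min H => // i Hi; have [s ->] := rE i (W m le_mn i Hi).
    by exists s; rewrite addrK; apply: mem_ideal_upto.
  have idJ := is_ideal_add p%:MP (is_ideal_upto r m).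
  have [J0 [JD JM]] := idJ => H.
  rewrite -[P](subrK (p%:MP * y)); apply: JD; last first.
    by exists y; rewrite subrr; case: (is_ideal_upto r m).
  apply: ideal_upto_min H => // i Hi; have [s Hs] := rE i (W m le_mn i Hi).
  exists (- s); rewrite mulrN opprK -Hs; exact: mem_ideal_upto.
have bp m (le_mn : (m <= n)%N) := binomial_ideal_prime (leq_trans le_mn le_nN) pp
  (fun i Hi => Hu i (W m le_mn i Hi)) (fun i Hi => Hv i (W m le_mn i Hi))
  (fun i Hi => Ha i (W m le_mn i Hi)) (fun i Hi => Hco i (W m le_mn i Hi)).
split; last 2 first.
- move=> P Q /(JE n _ (leqnn n)) H; have [pr _ _] := bp n (leqnn n).
  by case: (pr _ _ H) => H'; [left|right]; apply/(JE n _ (leqnn n)).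
- by move=> c /(JE n _ (leqnn n)) H; have [_ Hc _] := bp n (leqnn n); apply: Hc.
suff main m : (m <= n)%N -> forall P, ideal_upto r m (p%:MP * P) -> ideal_upto r m P by exact: main.
elim: m => [_ P [c]|m IH lt_mn P].
  rewrite big_ord0 => /eqP; rewrite mulf_eq0 mpolyC_eq0 => /orP[/eqP p0|/eqP->].
    by case: pp => [].
  by exists (fun=> 0); rewrite big_ord0.
have le_mn := ltnW lt_mn; have rng : (0 < m.+1 <= n)%N by [].
move=> /ideal_uptoS [c Hc]; have idI := is_ideal_upto r m; have [I0 [ID IM]] := idI.
have Jc : ideal_add (ideal_upto r m) p%:MP c.
  have [pr _ /(_ (leq_trans lt_mn le_nN) (Hu _ rng) (Ha _ rng)) nJ] := bp m le_mn.
  apply/(JE m _ le_mn).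
  have [|//|/nJ//] := pr c (@binomial_rel K N u v a b m.+1).
  apply/(JE m _ le_mn); have [s rs] := rE _ rng.
  exists (P - c * s); have -> : c * binomial_rel N u v a b m.+1 - p%:MP * (P - c * s)
     = (-1) * (p%:MP * P - c * r m.+1) by rewrite rs; ring.
  exact: IM.
have [c' Hc'] := Jc.
(* Writing [c] as [p * c'] modulo the first [m] relations turns [p * P - c * r m.+1] into
   [p * (P - c' * r m.+1)], to which the induction hypothesis applies. *)
apply/ideal_uptoS; exists c'; apply: IH => //.
have -> : p%:MP * (P - c' * r m.+1) = (p%:MP * P - c * r m.+1) + r m.+1 * (c - p%:MP * c') by ring.
by apply: ID => //; apply: IM.
Qed.

(** * The quotient ring *)

Lemma rmorphism_factor (S A E : comPzRingType) (phi : {rmorphism S -> A})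
    (psi : {rmorphism S -> E}) :
  (forall y, exists x, phi x = y) -> (forall x, phi x = 0 -> psi x = 0) ->
  exists j : {rmorphism A -> E}, forall x, j (phi x) = psi x.
Proof.
move=> surj ker.
have sb y : exists x, phi x == y by have [x <-] := surj y; exists x.
pose g y := psi (xchoose (sb y)).
have gE x : g (phi x) = psi x.
  apply/eqP; rewrite -subr_eq0 -rmorphB; apply/eqP/ker.
  by rewrite rmorphB (eqP (xchooseP (sb (phi x)))) subrr.
have gadd : zmod_morphism g.
  by move=> x y; have [[p <-] [q <-]] := (surj x, surj y); rewrite -rmorphB !gE rmorphB.
have gmul : monoid_morphism g.
  split; first by rewrite -(rmorph1 phi) gE rmorph1.
  by move=> x y; have [[p <-] [q <-]] := (surj x, surj y); rewrite -rmorphM !gE rmorphM.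
pose ga := GRing.isZmodMorphism.Build _ _ g gadd.
pose gm := GRing.isMonoidMorphism.Build _ _ g gmul.
pose gg : {rmorphism A -> E} := HB.pack g ga gm.
by exists gg.
Qed.

Lemma fraction_extend (R : idomainType) (L : fieldType) (f : {rmorphism R -> L}) :
  injective f -> exists g : {rmorphism {fraction R} -> L}, forall x, g (tofrac x) = f x.
Proof.
move=> inj.
have f0 x : x != 0 -> f x != 0 by move=> nzx; rewrite -(rmorph0 f) (inj_eq inj).
have t0 (x : R) : x != 0 -> tofrac x != 0 by rewrite tofrac_eq0.
have sb (z : {fraction R}) : exists w : R * R, (w.2 != 0) && (z == tofrac w.1 / tofrac w.2).
  by have [x [y [nzy ->]]] := fractionP z; exists (x, y); rewrite nzy eqxx.
pose g z := let w := xchoose (sb z) in f w.1 / f w.2.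
have gE x y : y != 0 -> g (tofrac x / tofrac y) = f x / f y.
  move=> nzy; rewrite /g; have /andP[] := xchooseP (sb (tofrac x / tofrac y)).
  case: (xchoose _) => x' y' /= nzy'; rewrite eqr_div ?t0 // -!tofracM tofrac_eq => /eqP E.
  by apply/eqP; rewrite eqr_div ?f0 // -!rmorphM E.
have gT x : g (tofrac x) = f x.
  by rewrite -[tofrac x]divr1 -tofrac1 gE ?oner_neq0 // rmorph1 divr1.
have gadd : zmod_morphism g.
  move=> z w; have [x [y [nzy ->]]] := fractionP z; have [x' [y' [nzy' ->]]] := fractionP w.
  rewrite -mulNr -tofracN addf_div ?t0 // -!tofracM -tofracD !gE ?mulf_neq0 //.
  by rewrite -mulNr addf_div ?f0 // rmorphD !rmorphM rmorphN.
have gmul : monoid_morphism g.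
  split; first by rewrite -tofrac1 gT rmorph1.
  move=> z w; have [x [y [nzy ->]]] := fractionP z; have [x' [y' [nzy' ->]]] := fractionP w.
  by rewrite mulf_div -!tofracM !gE ?mulf_neq0 // mulf_div !rmorphM.
pose ga := GRing.isZmodMorphism.Build _ _ g gadd.
pose gm := GRing.isMonoidMorphism.Build _ _ g gmul.
pose gg : {rmorphism {fraction R} -> L} := HB.pack g ga gm.
by exists gg.
Qed.

Lemma mpoly_rmorph_ext (n : nat) (R : comNzRingType) (S : comPzRingType)
    (f g : {rmorphism {mpoly R[n]} -> S}) :
  (forall c, f c%:MP = g c%:MP) -> (forall i, f 'X_i = g 'X_i) -> f =1 g.
Proof.
move=> HC HX; elim/mpolyind => [|c m p _ _ IH]; first by rewrite !rmorph0.
rewrite !rmorphD IH -mul_mpolyC !rmorphM HC mpolyXE_id !rmorph_prod; congr (_ * _ + _).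
by apply: eq_bigr => i _; rewrite !rmorphXn HX.
Qed.

Lemma mpoly_common_denominator (n : nat) (K : idomainType) (e : {mpoly {fraction K}[n]}) :
  exists2 c : K, c != 0 & exists x, (tofrac c)%:MP * e = map_mpoly (@tofrac K) x.
Proof.
elim/mpolyind: e => [|t m e _ _ [c nzc [x Hx]]].
  by exists 1; rewrite ?oner_neq0 //; exists 0; rewrite mulr0 rmorph0.
have [y [z [nzz ->]]] := fractionP t; exists (z * c); first by rewrite mulf_neq0.
exists ((c * y) *: 'X_[m] + z *: x).
rewrite rmorphD /= !map_mpolyZ /= map_mpolyX -Hx tofracM mulrDr -!mul_mpolyC mulrA.
rewrite -!mpolyCM mulrA -mpolyCM tofracM; congr (_%:MP * _ + _).
by rewrite [tofrac z * _]mulrC -mulrA [tofrac z * _]mulrCA divff ?tofrac_eq0 // mulr1.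
Qed.

Lemma factorial_scale (R : comPzRingType) (x : R) : is_factorial R -> x <> 0 ->
  exists w y, [/\ w * x = y, product_of (@is_prime_elt R) y & is_unit w].
Proof.
move=> fac nzx; have [u [c [[w uw] Pc ->]]] := fac x nzx.
by exists w, c; rewrite mulrA [w * u]mulrC uw mul1r; split=> //; exists u; rewrite mulrC.
Qed.

Lemma prime_divides_exp (R : comPzRingType) (p t : R) (k : nat) :
  is_prime_elt p -> divides p (t ^+ k) -> divides p t.
Proof.
move=> [_ [nup pr]]; elim: k => [|k IH]; first by move=> [c Hc]; case: nup; exists c.
by rewrite exprS => /pr [].
Qed.

(** Inverting [t] makes [D] and [A] coincide, and [p] stays prime there because it does not divide
    [t]. Primality returns to [A] because none of the prime factors of [d t] divides [d p], so
    powers of [d t] can be cancelled. *)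
Lemma prime_localization (D A : comPzRingType) (d : {rmorphism D -> A}) (t p : D)
    (u c : A) (P : A -> Prop) :
  is_domain A -> injective d -> (forall q, P q -> is_prime_elt q) ->
  is_unit u -> product_of P c -> d t = u * c ->
  (forall x, exists k x', d t ^+ k * x = d x') ->
  is_prime_elt p -> ~ divides p t -> (forall q, P q -> ~ divides q (d p)) ->
  is_prime_elt (d p).
Proof.
move=> dom inj PP uu Pc dt loc pp npt ncop.
have cancel_t k x : divides (d p) (d t ^+ k * x) -> divides (d p) x.
  elim: k => [|k IH]; first by rewrite mul1r.
  rewrite exprS dt -!mulrA => /(divides_unit_mul uu) /(coprime_divides_mul dom PP Pc ncop).
  by rewrite -dt; apply: IH.
have [nzp [nup pr]] := pp; split.
  by move=> dp0; apply: nzp; apply: inj; rewrite dp0 rmorph0.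
split=> [[x Hx]|x y [z Hz]].
  have [k [x' Hx']] := loc x; apply: npt; apply: (prime_divides_exp (k := k) pp).
  by exists x'; apply: inj; rewrite rmorphM rmorphXn -Hx' mulrCA Hx mulr1.
have [k [x' Hx']] := loc x; have [l [y' Hy']] := loc y; have [m [z' Hz']] := loc z.
have E : x' * y' * t ^+ m = p * (t ^+ (k + l) * z').
  apply: inj; rewrite !rmorphM !rmorphXn -Hx' -Hy' -Hz' exprD.
  have -> : d t ^+ k * x * (d t ^+ l * y) * d t ^+ m
    = d t ^+ k * d t ^+ l * d t ^+ m * (x * y) by ring.
  by rewrite Hz; ring.
have [|pxy|ptm] := pr (x' * y') (t ^+ m); first by rewrite E; exists (t ^+ (k + l) * z').
  by have [[e He]|[e He]] := pr _ _ pxy; [left; apply: (cancel_t k)|right; apply: (cancel_t l)];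
     rewrite ?Hx' ?Hy' He rmorphM; exists (d e).
by case: npt; apply: prime_divides_exp ptm.
Qed.

Lemma second_order_recursion (T : Type) (x0 x1 : T) (F : nat -> T -> T -> T) :
  exists z : nat -> T, [/\ z 0%N = x0, z 1%N = x1 & forall i, z i.+2 = F i (z i) (z i.+1)].
Proof.
pose zz := fix zz i := if i is k.+1 then ((zz k).2, F k (zz k).1 (zz k).2) else (x0, x1).
by exists (fun i => (zz i).1).
Qed.

Lemma mpoly_eval (n : nat) (R S : comNzRingType) (f : {rmorphism R -> S}) (h : 'I_n -> S) :
  exists g : {rmorphism {mpoly R[n]} -> S},
    (forall c, g c%:MP = f c) /\ (forall i, g 'X_i = h i).
Proof.
exists (mmap f h : {rmorphism {mpoly R[n]} -> S}).
by split=> *; rewrite /= ?mmapC // mmapX mmap1U.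
Qed.

(* [j] presents [A] as a subring of [Frac(K)[X_0, X_1]], [d] is the inclusion of
   [K[Z_0, Z_1]], and [t] is the product of the [f i]. *)
Lemma quotient_embedding (K : idomainType) (n : nat) (u v f : nat -> K) (a b : nat -> nat)
  (HK_ufd : is_UFD K)
  (Hu : forall i, (1 <= i <= n)%N -> u i \is a GRing.unit)
  (Hv : forall i, (1 <= i <= n)%N -> v i \is a GRing.unit)
  (Ha : forall i, (1 <= i <= n)%N -> (0 < a i)%N)
  (Hgcd : forall i, (1 <= i <= n)%N -> coprime (a i) (\prod_(1 <= j < i.+1) b j)%N)
  (Hf0 : forall i, (1 <= i <= n)%N -> f i != 0)
  (Hfprimes : forall i j, (1 <= i <= n)%N -> (1 <= j <= n)%N ->
     forall p : K, is_prime_elt p -> (divides p (f i) <-> divides p (f j)))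
  (A : comPzRingType) (phi : {rmorphism {mpoly K[n.+2]} -> A})
  (Hphi_surj : forall y : A, exists p, phi p = y)
  (Hphi_ker : forall p, phi p = 0 <-> ideal_upto (gen_rel n f u v a b) n p) :
  exists (j : {rmorphism A -> {mpoly {fraction K}[2]}}) (d : {rmorphism {mpoly K[2]} -> A}) (t : K),
  [/\ injective j, forall x, j (d x) = map_mpoly (@tofrac K) x, t != 0,
      forall x, exists k x', d t%:MP ^+ k * x = d x'
    & forall p, is_prime_elt p -> divides p t ->
        is_prime_elt (d p%:MP) /\ forall c, divides (d p%:MP) (d c%:MP) -> divides p c].
Proof.
pose F := {fraction K}; pose E := {mpoly F[2]}.
pose cst : {rmorphism K -> E} := @mpolyC 2 F \o @tofrac K.
(* The images of the [Z_i], found by solving relation [i.+1] for [Z_{i+2}] with [f i.+1]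
   inverted. *)
have [z [z0 z1 zSS]] := second_order_recursion ('X_(inord 0) : E) 'X_(inord 1) (fun i x y =>
  - ((tofrac (f i.+1))^-1)%:MP * (cst (u i.+1) * y ^+ a i.+1 + cst (v i.+1) * x ^+ b i.+1)).
have cstV c : c != 0 -> cst c * ((tofrac c)^-1)%:MP = 1.
  by move=> nzc; rewrite -mpolyCM mulfV ?tofrac_eq0 // mpolyC1.
have [psi [psiC psi_X]] := mpoly_eval cst (fun j : 'I_n.+2 => z j).
have psiX i : (i < n.+2)%N -> psi 'X_(inord i) = z i by move=> Hi; rewrite psi_X inordK.
have [d0 [d0C d0X]] := mpoly_eval (@mpolyC n.+2 K : {rmorphism K -> {mpoly K[n.+2]}})
  (fun j : 'I_2 => 'X_(inord j) : {mpoly K[n.+2]}).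
have [incl [inclE inclC inclX]] : exists g : {rmorphism {mpoly K[2]} -> E},
    [/\ g =1 map_mpoly (@tofrac K), forall c, g c%:MP = cst c & forall i, g 'X_i = 'X_i].
  exists (map_mpoly (@tofrac K) : {rmorphism {mpoly K[2]} -> E}).
  by split=> [//|c|i]; rewrite /= ?map_mpolyC ?map_mpolyX.
clearbody cst.
have psi_rel i : (1 <= i <= n)%N -> psi (gen_rel n f u v a b i) = 0.
  case: i => // i rng; have [_ lt_in] := andP rng.
  have [Z0 Z1 Z2] : [/\ psi 'X_(inord i) = z i, psi 'X_(inord i.+1) = z i.+1
      & psi 'X_(inord i.+2) = z i.+2] by split; apply: psiX; lia.
  rewrite /gen_rel !rmorphD !rmorphM !rmorphXn !psiC /= Z0 Z1 Z2 zSS.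
  rewrite mulrA mulrN (cstV _ (Hf0 _ rng)); ring.
have psi_ker x : phi x = 0 -> psi x = 0.
  move/Hphi_ker; move: x; apply: (ideal_upto_min (I := fun x => psi x = 0)) => //.
  split; first by rewrite rmorph0.
  by split=> [x y Hx Hy|r x Hx]; rewrite ?rmorphD ?rmorphM ?Hx ?Hy ?addr0 ?mulr0.
have [j jE] := rmorphism_factor Hphi_surj psi_ker.
pose d : {rmorphism {mpoly K[2]} -> A} := phi \o d0.
have dC c : d c%:MP = phi c%:MP by rewrite /d /= d0C.
have jd x : j (d x) = incl x.
  rewrite [j _]jE; move: x; apply: (@mpoly_rmorph_ext _ _ _ (psi \o d0) incl) => [c|i] /=.
    by rewrite d0C psiC inclC.
  rewrite d0X psiX ?inclX ?(leq_trans (ltn_ord i)) //.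
  rewrite -[i in RHS]inord_val; case: i => -[|[|//]] //= _.
have inj_incl : injective incl.
  by move=> x y; rewrite !inclE => /(map_mpoly_inj (@tofrac_inj K)).
have inj_d : injective d by move=> x y /(congr1 j); rewrite !jd => /inj_incl.
pose t := \prod_(r <- [seq f i | i <- iota 1 n]) r.
have nzt : t != 0.
  rewrite /t prodf_seq_neq0; apply/allP => r /mapP [i]; rewrite mem_iota add1n ltnS => rng ->.
  by rewrite /= Hf0.
have divA p P : divides (d p%:MP) (phi P) <->
    ideal_add (ideal_upto (gen_rel n f u v a b) n) p%:MP P.
  split=> [[x]|[Q /Hphi_ker]].
    have [Q <-] := Hphi_surj x; rewrite dC -rmorphM => PQ.
    by exists Q; apply/Hphi_ker; rewrite rmorphB PQ subrr.
  by rewrite rmorphB rmorphM => /eqP; rewrite subr_eq0 => /eqP ->; exists (phi Q); rewrite dC.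
have bad p : is_prime_elt p -> divides p t ->
    [/\ forall x, d p%:MP * x = 0 -> x = 0, is_prime_elt (d p%:MP)
      & forall c, divides (d p%:MP) (d c%:MP) -> divides p c].
  move=> pp /(prime_divides_prod pp) [_ /mapP [i0 Hi0 ->] pi0].
  rewrite mem_iota add1n ltnS in Hi0.
  have [|tf pr con] := @torsion_free_upto K n.+1 n u v f a b p (gen_rel n f u v a b)
     (leqnSn n) pp Hu Hv Ha Hgcd.
    move=> i rng; have [e fe] := (Hfprimes i0 i Hi0 rng p pp).1 pi0.
    exists (e%:MP * 'X_(inord i.+1)); rewrite /gen_rel /binomial_rel fe mpolyCM; ring.
  have con' c : divides (d p%:MP) (d c%:MP) -> divides p c by rewrite (dC c) => /divA /con.
  split=> //.
    move=> x; have [P <-] := Hphi_surj x; rewrite dC -rmorphM => /Hphi_ker /tf.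
    by move/Hphi_ker.
  split.
    move=> dp0; case: pp => nzp _; apply: nzp; apply/eqP.
    by rewrite -(mpolyC_eq0 2); apply/eqP/inj_d; rewrite dp0 rmorph0.
  split.
    move=> [x Hx]; case: pp => _ [nup _]; apply: nup.
    by have [|e He] := con' 1; [rewrite mpolyC1 rmorph1; exists x | exists e].
  move=> x y; have [[P <-] [Q <-]] := (Hphi_surj x, Hphi_surj y).
  by rewrite -rmorphM => /divA /pr [] /divA; [left|right].
(* Up to a unit [t] is a product of primes, each dividing [t] and hence regular by [bad]. *)
have t_reg k x : d t%:MP ^+ k * x = 0 -> x = 0.
  elim: k => [|k IH]; rewrite ?mul1r // exprS -mulrA; move: (_ ^+ k * x) IH => y IH H; apply: IH.
  have [w [c [wt [s [Hs cE]] uw]]] := factorial_scale (UFD_factorial HK_ufd) (elimN eqP nzt).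
  have reg r : product_of (fun q => is_prime_elt q /\ divides q t) r ->
      forall y, d r%:MP * y = 0 -> y = 0.
    apply: (product_of_ind (Q := fun r => forall y, d r%:MP * y = 0 -> y = 0)).
      by move=> z'; rewrite mpolyC1 rmorph1 mul1r.
    move=> p r' [pp pt] IHr z'; have [tf _ _] := bad p pp pt.
    by rewrite mpolyCM rmorphM -mulrA => /tf /IHr.
  apply: (reg c); last by rewrite -wt mpolyCM rmorphM -mulrA H mulr0.
  exists s; split=> // r rs; split; first exact: Hs.
  apply: (divides_unit_mul uw); rewrite wt cE (big_rem r) //=.
  by exists (\prod_(q <- rem r s) q).
(* These elements form a subring containing the constants, so it suffices to reach the [Z_i]; the
   relations do this, as every [f i] divides [t]. *)
pose G x := exists k x', d t%:MP ^+ k * x = d x'.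
have GC x : G (d x) by exists 0%N, x; rewrite mul1r.
have GD x y : G x -> G y -> G (x + y).
  move=> [k [x' Hx]] [l [y' Hy]]; exists (k + l)%N, (t%:MP ^+ l * x' + t%:MP ^+ k * y').
  by rewrite rmorphD !rmorphM !rmorphXn -Hx -Hy exprD; ring.
have GM x y : G x -> G y -> G (x * y).
  move=> [k [x' Hx]] [l [y' Hy]]; exists (k + l)%N, (x' * y').
  by rewrite rmorphM -Hx -Hy exprD; ring.
have GX k x : G x -> G (x ^+ k).
  by move=> Gx; elim: k => [|k IH]; [rewrite expr0 -(rmorph1 d) | rewrite exprS; apply: GM].
(* Two consecutive indices are carried along because relation [i.+1] expresses [Z_{i+2}] through
   both of its predecessors. *)
have GZ i : (i < n.+2)%N -> G (phi 'X_(inord i)) /\ ((i.+1 < n.+2)%N -> G (phi 'X_(inord i.+1))).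
  have dX k : (k < 2)%N -> phi 'X_(inord k) = d 'X_(inord k) by move=> lt_k2; rewrite /d /= d0X inordK.
  elim: i => [_|i IH lt_in]; first by rewrite !dX.
  have [Gi /(_ lt_in) Gi1] := IH (ltnW lt_in); split=> // lt_i1n.
  have rng : (1 <= i.+1 <= n)%N by lia.
  have rel0 : phi (gen_rel n f u v a b i.+1) = 0 by apply/Hphi_ker/mem_ideal_upto.
  have [e te] : divides (f i.+1) t.
    rewrite /t (big_rem (f i.+1)) /=; first by eexists.
    by apply: map_f; rewrite mem_iota add1n ltnS.
  suff [k [x' Hx]] : G (d t%:MP * phi 'X_(inord i.+2)) by exists k.+1, x'; rewrite exprSr -mulrA.
  move: rel0; rewrite /gen_rel !rmorphD !rmorphM !rmorphXn /= -!dC => rel0.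
  have -> : d t%:MP * phi 'X_(inord i.+2) = d (- e)%:MP * (d (u i.+1)%:MP * phi 'X_(inord i.+1) ^+ a i.+1
      + d (v i.+1)%:MP * phi 'X_(inord i) ^+ b i.+1).
    apply/eqP; rewrite -subr_eq0; apply/eqP; rewrite -(mulr0 (d e%:MP)) -rel0 te.
    by rewrite mpolyCM mpolyCN rmorphM rmorphN; ring.
  by apply: (GM) => //; apply: (GD); apply: (GM) => //; apply: GX.
have loc x : G x.
  have [P <-] := Hphi_surj x; elim/mpolyind: P => [|c M P _ _ IH]; first by rewrite rmorph0 -(rmorph0 d).
  rewrite rmorphD -mul_mpolyC rmorphM -dC mpolyXE_id rmorph_prod; apply: (GD) => //.
  apply: (GM) => //; elim/big_ind: _ => [||i _]; [by rewrite -(rmorph1 d) | exact: GM|].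
  by rewrite rmorphXn; apply: GX; rewrite -[i]inord_val; case: (GZ i (ltn_ord i)).
exists j, d, t; split=> //.
(* A power of [t] brings [x] into [K[Z_0, Z_1]], where [j] is the inclusion; regularity of [t] then
   gives [x = 0]. *)
- apply: raddf_inj => x jx0; have [k [x' Hx]] := loc x; apply: (t_reg k).
  have x'0 : x' = 0.
    by apply: inj_incl; rewrite -jd -Hx rmorphM jx0 mulr0 rmorph0.
  by rewrite Hx x'0 rmorph0.
- by move=> x; rewrite jd inclE.
- by move=> p pp pt; have [] := bad p pp pt.
Qed.

(** * Factoriality of the quotient and its fraction field *)

Lemma gen_rels_ideal (K : idomainType) (n : nat) (f u v : nat -> K) (a b : nat -> nat)
    (p : {mpoly K[n.+2]}) :
  ideal_generated_by (gen_rels n f u v a b) p <-> ideal_upto (gen_rel n f u v a b) n p.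
Proof.
have mem g : g \in gen_rels n f u v a b -> ideal_upto (gen_rel n f u v a b) n g.
  by move=> /mapP [i]; rewrite mem_iota add1n ltnS => rng ->; apply: mem_ideal_upto.
split; first by apply: ideal_generated_min => //; apply: is_ideal_upto.
apply: ideal_upto_min; first exact: is_ideal_generated.
move=> i rng; apply: mem_ideal_generated; apply: map_f.
by rewrite mem_iota add1n ltnS.
Qed.

Lemma divides_prod_mem (R : comPzRingType) (s : seq R) (r : R) :
  r \in s -> divides r (\prod_(q <- s) q).
Proof. by move=> rs; rewrite (big_rem r) //=; eexists. Qed.

(** Nagata's criterion for [A], with the images of all primes of [K] as [P]. The embedding [j] makes
    [A] a domain; a prime of [K] stays prime in [A] by [bad] if it divides [t], and by
    [prime_localization] otherwise. *)
Lemma factorial_between (K : idomainType) (A : comPzRingType)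
    (j : {rmorphism A -> {mpoly {fraction K}[2]}}) (d : {rmorphism {mpoly K[2]} -> A}) (t : K) :
  is_factorial K -> is_noetherian A -> injective j ->
  (forall x, j (d x) = map_mpoly (@tofrac K) x) -> t != 0 ->
  (forall x, exists k x', d t%:MP ^+ k * x = d x') ->
  (forall p, is_prime_elt p -> divides p t ->
    is_prime_elt (d p%:MP) /\ forall c, divides (d p%:MP) (d c%:MP) -> divides p c) ->
  is_UFD A.
Proof.
move=> facK noeA inj_j jd nzt loc bad.
have jdC c : j (d c%:MP) = (tofrac c)%:MP by rewrite jd map_mpolyC.
have dom : is_domain A.
  have [nz1 domE] := is_domain_idomain {mpoly {fraction K}[2]}; split.
    by move=> /(congr1 j); rewrite rmorph1 rmorph0.
  move=> x y xy0; have [|jx|jy] := domE (j x) (j y); first by rewrite -rmorphM xy0 rmorph0.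
    by left; apply: inj_j; rewrite jx rmorph0.
  by right; apply: inj_j; rewrite jy rmorph0.
apply: factorial_UFD => //.
have inj_d : injective d.
  by move=> x y /(congr1 j); rewrite !jd => /(map_mpoly_inj (@tofrac_inj K)).
have unit_d w : is_unit w -> is_unit (d w%:MP).
  by move=> [w' ww']; exists (d w'%:MP); rewrite -rmorphM -mpolyCM ww' mpolyC1 rmorph1.
have pd p : is_prime_elt p -> is_prime_elt (d p%:MP).
  move=> pp; have [/(bad p pp) []//|npt] := classic (divides p t).
  have [u [c [uu [s [Hs ->]] tE]]] := facK t (elimN eqP nzt).
  pose P (q : A) := exists r, [/\ is_prime_elt r, divides r t & q = d r%:MP].
  apply: (@prime_localization _ _ d t%:MP p%:MP (d u%:MP) (d (\prod_(r <- s) r)%:MP) P) => //.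
  - by move=> _ [r [pr rt ->]]; have [] := bad r pr rt.
  - exact: unit_d.
  - rewrite !rmorph_prod -(big_map (fun r => d r%:MP) xpredT id); exists [seq d r%:MP | r <- s].
    split=> // _ /mapP [r rs ->]; exists r; split=> //; first exact: Hs.
    by rewrite tE; apply/divides_mull/divides_prod_mem.
  - by rewrite -rmorphM -mpolyCM -tE.
  - exact: prime_mpolyC.
  - by move=> /divides_mpolyC /(_ 0%MM); rewrite mcoeffC eqxx mulr1.
  (* The second clause of [bad] brings the divisibility from [A] back to [K], where [r] and [p]
     would be associate and [p] would divide [t]. *)
  move=> _ [r [pr rt ->]] /(proj2 (bad r pr rt)) rp; apply: npt.
  have [w uw pE] := prime_divides_prime (is_domain_idomain K) pr pp rp.
  have [e te] := rt; have [w' ww'] := uw; exists (w' * e).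
  by rewrite te pE mulrA -[r * w * w']mulrA ww' mulr1.
pose P (q : A) := exists2 r : K, is_prime_elt r & q = d r%:MP.
apply: (@factorial_localization _ _ j P) => //.
- exact: is_domain_idomain.
- by move=> _ [r pr ->]; apply: pd.
- move=> _ [r [/eqP nzr _] ->]; rewrite jdC; exists ((tofrac r)^-1)%:MP.
  by rewrite -mpolyCM mulfV ?tofrac_eq0 // mpolyC1.
- move=> e; have [c nzc [x Hx]] := mpoly_common_denominator e.
  have [w [y [wc [s [Hs yE]] _]]] := factorial_scale facK (elimN eqP nzc).
  exists (d (\prod_(r <- s) r)%:MP), (d (w%:MP * x)); split.
    rewrite !rmorph_prod -(big_map (fun r => d r%:MP) xpredT id); exists [seq d r%:MP | r <- s].
    by split=> // _ /mapP [r rs ->]; exists r => //; apply: Hs.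
  by rewrite jdC jd rmorphM /= map_mpolyC -Hx mulrA -mpolyCM -tofracM wc yE.
- exact/factorial_mpoly/factorial_field/noetherian_field.
Qed.

Lemma fraction_scale (L : fieldType) (c1 c2 x y : L) :
  c1 != 0 -> c2 != 0 -> c2 * (c1 * x) / (c1 * (c2 * y)) = x / y.
Proof.
by move=> nz1 nz2; rewrite mulrCA -mulf_div divff // mul1r -mulf_div divff // mul1r.
Qed.

(** Surjectivity comes from clearing the coefficients' denominators in the numerator and in the
    denominator of a fraction. Both directions are recorded: the inverse identifies the fraction
    field of [A], the map itself compares with the rational functions over the fraction field of
    [K]. *)
Lemma fraction_map_bijective (K : idomainType) (n : nat) :
  exists h : {rmorphism {fraction {mpoly K[n]}} -> {fraction {mpoly {fraction K}[n]}}},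
    bijective h /\
    exists g : {rmorphism {fraction {mpoly {fraction K}[n]}} -> {fraction {mpoly K[n]}}},
      bijective g.
Proof.
pose F := {fraction K}.
pose incl : {rmorphism {mpoly K[n]} -> {fraction {mpoly F[n]}}} :=
  @tofrac {mpoly F[n]} \o map_mpoly (@tofrac K).
have inj_incl : injective incl.
  by move=> x y /tofrac_inj /(map_mpoly_inj (@tofrac_inj K)).
have [h hE] := fraction_extend inj_incl.
have surj y : exists x, h x = y.
  have [e1 [e2 [nze2 ->]]] := fractionP y.
  have [c1 nzc1 [x1 Hx1]] := mpoly_common_denominator e1.
  have [c2 nzc2 [x2 Hx2]] := mpoly_common_denominator e2.
  exists (tofrac (c2%:MP * x1) / tofrac (c1%:MP * x2)).
  rewrite fmorph_div !hE /incl /= !rmorphM /= !map_mpolyC -Hx1 -Hx2 !tofracM.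
  have nz (c : K) : c != 0 -> tofrac ((tofrac c)%:MP_[n] : {mpoly F[n]}) != 0.
    by move=> nzc; rewrite tofrac_eq0 mpolyC_eq0 tofrac_eq0.
  by rewrite fraction_scale ?nz.
have [g [hK gK]] := bijective_inverse (fmorph_inj h) surj.
by exists h; split; [exists g | exists g; exists h].
Qed.


Theorem theorem4p2 (K : idomainType) (n : nat)
  (u v f : nat -> K) (a b : nat -> nat)
  (HK_noeth : is_noetherian K) (HK_ufd : is_UFD K)
  (Hu : forall i, (1 <= i <= n)%N -> u i \is a GRing.unit)
  (Hv : forall i, (1 <= i <= n)%N -> v i \is a GRing.unit)
  (Ha : forall i, (1 <= i <= n)%N -> (0 < a i)%N)
  (Hb : forall i, (1 <= i <= n)%N -> (0 < b i)%N)
  (Hgcd : forall i, (1 <= i <= n)%N ->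
            coprime (a i) (\prod_(1 <= j < i.+1) b j)%N)
  (Hf0 : forall i, (1 <= i <= n)%N -> f i != 0)
  (Hfprimes : forall i j, (1 <= i <= n)%N -> (1 <= j <= n)%N ->
     forall p : K, is_prime_elt p -> (divides p (f i) <-> divides p (f j)))
  (* A is the quotient ring A_n = K[Z_0,...,Z_{n+1}] / (generators) *)
  (A : comPzRingType) (phi : {rmorphism {mpoly K[n.+2]} -> A})
  (Hphi_surj : forall y : A, exists p, phi p = y)
  (Hphi_ker : forall p, phi p = 0 <-> ideal_generated_by (gen_rels n f u v a b) p) :
  is_UFD A /\
  exists (L : fieldType) (iota : {rmorphism A -> L}),
    is_fraction_field iota /\
    (exists h : {rmorphism L -> {fraction {mpoly K[2]}}}, bijective h) /\
    (exists h' : {rmorphism {fraction {mpoly K[2]}} ->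
                            {fraction {mpoly {fraction K}[2]}}}, bijective h').
Proof.
have ker p : phi p = 0 <-> ideal_upto (gen_rel n f u v a b) n p.
  by rewrite Hphi_ker; apply: gen_rels_ideal.
have [j [d [t [inj_j jd nzt loc bad]]]] :=
  quotient_embedding HK_ufd Hu Hv Ha Hgcd Hf0 Hfprimes Hphi_surj ker.
split.
  apply: (factorial_between _ _ inj_j jd nzt loc bad); first exact: UFD_factorial.
  exact: (noetherian_surj Hphi_surj (@noetherian_mpoly K n.+2 HK_noeth)).
pose E := {mpoly {fraction K}[2]}.
(* The field of fractions of [E] already serves for [A]: through [d] the ring [A] contains
   [K[Z_0, Z_1]], whose quotients exhaust this field once denominators are cleared. *)
pose iota : {rmorphism A -> {fraction E}} := @tofrac E \o j.
exists {fraction E}, iota.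
have [h [bij_h [g bij_g]]] := fraction_map_bijective K 2.
split; last by split; [exists g | exists h].
split; first by move=> x y /tofrac_inj /inj_j.
move=> z; have [e1 [e2 [nze2 ->]]] := fractionP z.
have [c1 nzc1 [x1 Hx1]] := mpoly_common_denominator e1.
have [c2 nzc2 [x2 Hx2]] := mpoly_common_denominator e2.
have nz (c : K) : c != 0 -> (tofrac c)%:MP_[2] != 0 by move=> nzc; rewrite mpolyC_eq0 tofrac_eq0.
exists (d (c2%:MP * x1)), (d (c1%:MP * x2)).
rewrite /iota /= !jd !rmorphM /= !map_mpolyC -Hx1 -Hx2; split.
  by apply: mulf_neq0; rewrite tofrac_eq0 ?mulf_neq0 ?nz.
by rewrite !tofracM fraction_scale ?tofrac_eq0 ?nz.
Qed.
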